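(* Let $\mu\in(0,\mu^* )$ be given, let $c(t;\omega,\mu)=\frac{e^{\mu}+e^{-\mu}-2+a(\theta_t\omega)}{\mu}$, and let $u(t;\omega)=\{u_i(t;\omega)\}_{i\in\mathbb{Z}}$, $u_i(t;\omega)=\Phi\big(i-\int_0^t c(s;\omega,\mu)\,ds,\theta_t\omega\big)$, be a random transition front of $$\dot{u}_i(t)=u_{i+1}(t)-2u_i(t)+u_{i-1}(t)+a(\theta_t\omega)u_i(t)(1-u_i(t)),\qquad i\in\mathbb{Z},\qquad (\ast)$$ with $$\lim_{i\to\infty}\frac{u_i(t;\omega)}{e^{-\mu(i-\int_0^t c(s;\omega,\mu)\,ds)}}=1,$$ where the properties of the front (being an entire solution of $(\ast)$, the bounds and limits of the profile, and the asymptotics $\lim_{i\to\infty}u_i(t;\omega)\big/e^{-\mu(i-\int_0^t c(s;\omega,\mu)\,ds)}=1$ for each $t\in\mathbb{R}$) hold for every $\omega\in\Omega_0$. Then this front is asymptotically stable, that is, for any $\omega\in\Omega_0$ and any $u^0\in l^\infty(\mathbb{Z})$ satisfying $$\inf_{i\le i_0}u^0_i>0\quad\text{for all } i_0\in\mathbb{Z},\qquad \lim_{i\to\infty}\frac{u^0_i}{u_i(0;\omega)}=1,$$ there holds $$\lim_{t\to\infty}\Big\|\frac{u_\cdot(t;u^0,\omega)}{u_\cdot(t;\omega)}-1\Big\|_{l^\infty}=0 .$$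
   Context: Setting: $(\Omega,\mathcal{F},\mathbb{P})$ is a probability space, $\{\theta_t\}_{t\in\mathbb{R}}$ is an ergodic metric dynamical system on it (a jointly measurable, measure-preserving, ergodic flow on $\Omega$), $a:\Omega\to(0,\infty)$ is measurable, and $t\mapsto a(\theta_t\omega)$ is locally H\''older continuous on $\mathbb{R}$ for every $\omega\in\Omega$. Define $$\underline{a}(\omega)=\liminf_{t-s\to\infty}\frac{1}{t-s}\int_s^t a(\theta_\tau\omega)\,d\tau:=\lim_{r\to\infty}\inf_{t-s\ge r}\frac{1}{t-s}\int_s^t a(\theta_\tau\omega)\,d\tau,$$ $$\overline{a}(\omega)=\limsup_{t-s\to\infty}\frac{1}{t-s}\int_s^t a(\theta_\tau\omega)\,d\tau:=\lim_{r\to\infty}\sup_{t-s\ge r}\frac{1}{t-s}\int_s^t a(\theta_\tau\omega)\,d\tau.$$ Standing assumption: $0<\underline{a}(\omega)\le\overline{a}(\omega)<\infty$ for a.e. $\omega\in\Omega$. By ergodicity there are constants $\underline{a},\overline{a}>0$ and a measurable set $\Omega_0\subset\Omega$ with $\mathbb{P}(\Omega_0)=1$, $\theta_t\Omega_0=\Omega_0$ for all $t\in\mathbb{R}$, and $\underline{a}(\omega)=\underline{a}$, $\overline{a}(\omega)=\overline{a}$ for all $\omega\in\Omega_0$; these are fixed. Let $c_0:=\inf_{\mu>0}\frac{e^{\mu}+e^{-\mu}-2+\underline{a}}{\mu}$, and let $\mu^*>0$ be the unique positive number with $c_0=\frac{e^{\mu^*}+e^{-\mu^*}-2+\underline{a}}{\mu^*}$.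 $l^\infty(\mathbb{Z})$ is the space of bounded real sequences indexed by $\mathbb{Z}$ with the sup norm. For $u^0\in l^\infty(\mathbb{Z})$, $u(t;u^0,\omega)=\{u_i(t;u^0,\omega)\}_{i\in\mathbb{Z}}$ denotes the unique solution of $(\ast)$ in $l^\infty(\mathbb{Z})$ with $u(0;u^0,\omega)=u^0$; it exists for all $t\ge0$ if $u^0_i\ge0$ for all $i$. An entire solution is a solution of $(\ast)$ defined for all $t\in\mathbb{R}$. An entire solution $u(t;\omega)$ is called a random transition front (connecting $1$ and $0$) if for a.e. $\omega\in\Omega$, $u_i(t;\omega)=\Phi(i-\int_0^t c(s;\omega)\,ds,\theta_t\omega)$ for some $\Phi(x,\omega)$ ($x\in\mathbb{R}$) and $c(t;\omega)$, both measurable in $\omega$, such that for a.e. $\omega\in\Omega$: $0<\Phi(x,\omega)<1$, and $\lim_{x\to-\infty}\Phi(x,\theta_t\omega)=1$, $\lim_{x\to\infty}\Phi(x,\theta_t\omega)=0$ uniformly in $t\in\mathbb{R}$. *)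

(* Defs.v *)
From HB Require Import structures.
From mathcomp Require Export all_boot all_order all_algebra.
From mathcomp Require Export all_classical all_reals all_analysis.

Set Implicit Arguments.
Unset Strict Implicit.
Unset Printing Implicit Defensive.

Export Order.TTheory GRing.Theory Num.Theory.
Export numFieldNormedType.Exports.

Open Scope classical_set_scope.
Open Scope ring_scope.

Section Flow.
Context {R : realType} {d : measure_display} {Omega : measurableType d}.
Implicit Types (P : probability Omega R) (theta : R -> Omega -> Omega).

Record metric_dynamical_system P theta : Prop := MetricDynamicalSystem {
  mds_measurable :
    measurable_fun [set: measurableTypeR R * Omega]
      (fun p : measurableTypeR R * Omega => theta p.1 p.2) ;
  mds0 : forall w, theta 0 w = w ;
  mdsD : forall s t w, theta (s + t) w = theta s (theta t w) ;
  mds_preserving : forall t (A : set Omega), measurable A ->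
    P (theta t @^-1` A) = P A }.

Definition ergodic P theta : Prop := forall A : set Omega, measurable A ->
  (forall t, theta t @^-1` A = A) -> P A = 0%E \/ P A = 1%E.

End Flow.

Section RealFunctions.
Context {R : realType}.
Implicit Types f : R -> R.

(* The Hoelder exponent and constant may depend on the neighbourhood. *)
Definition locally_hoelder f : Prop := forall t0 : R, exists alpha C : R,
  [/\ 0 < alpha, alpha <= 1 &
    exists2 U : set R, nbhs t0 U &
      forall s t : R, U s -> U t -> `|f s - f t| <= C * `|s - t| `^ alpha].

(* Oriented integral: the sign changes when t < s. *)
Definition oint f (s t : R) : R :=
  if s <= t then \int[lebesgue_measure]_(x in `[s, t]) f x
  else - \int[lebesgue_measure]_(x in `[t, s]) f x.

Definition averages f (r : R) : set (\bar R) :=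
  [set x | exists s t : R, r <= t - s /\ x = ((t - s)^-1 * oint f s t)%:E].

Definition lower_mean f : \bar R :=
  lim (ereal_inf (averages f r) @[r --> +oo]).

Definition upper_mean f : \bar R :=
  lim (ereal_sup (averages f r) @[r --> +oo]).

Definition speed (mu b : R) : R := (expR mu + expR (- mu) - 2 + b) / mu.

Definition minimal_speed (b : R) : R :=
  inf [set speed mu b | mu in [set mu : R | 0 < mu]].

End RealFunctions.

Section LatticeEquation.
Context {R : realType}.
Implicit Types (v : int -> R) (b : R -> R).

(* Sup norm with values in [0, +oo]; v is in l^oo(Z) iff it is finite. *)
Definition linf_norm v : \bar R := ereal_sup [set `|v i|%:E | i in [set: int]].

Definition linf v : Prop := (linf_norm v < +oo)%E.

Definition kpp (c : R) v (i : int) : R :=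
  v (i + 1) - 2 * v i + v (i - 1) + c * v i * (1 - v i).

Definition entire_solution b (u : R -> int -> R) : Prop :=
  forall (t : R) (i : int), is_derive t (1 : R) (u ^~ i) (kpp (b t) (u t) i).

(* The time derivative is taken in the norm of l^oo(Z); it is one-sided at
   t = 0. *)
Definition linf_forward_solution b (u0 : int -> R) (u : R -> int -> R) : Prop :=
  u 0 = u0 /\
  forall t, 0 <= t -> linf (u t) /\
    linf_norm (fun i => h^-1 * (u (t + h) i - u t i) - kpp (b t) (u t) i)
      @[h --> within [set h | 0 <= t + h] (0 : R)^'] --> 0%E.

End LatticeEquation.

Section Front.
Context {R : realType} {d : measure_display} {Omega : measurableType d}.
Implicit Types (P : probability Omega R) (theta : R -> Omega -> Omega)
  (a : Omega -> R) (u : R -> Omega -> int -> R)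
  (Phi : R -> Omega -> R) (c : R -> Omega -> R).

Record front_at theta a u Phi c (w : Omega) : Prop := FrontAt {
  front_entire : entire_solution (fun t => a (theta t w)) (fun t => u t w) ;
  front_profile : forall t i,
    u t w i = Phi (i%:~R - oint (c ^~ w) 0 t) (theta t w) ;
  front_bounds : forall x, 0 < Phi x w < 1 ;
  front_left : forall e : R, 0 < e ->
    \forall x \near -oo, forall t, `|Phi x (theta t w) - 1| < e ;
  front_right : forall e : R, 0 < e ->
    \forall x \near +oo, forall t, `|Phi x (theta t w)| < e }.

Record random_transition_front P theta a u Phi c : Prop :=
  RandomTransitionFront {
  rtf_Phi_measurable : forall x : R, measurable_fun [set: Omega] (Phi x) ;
  rtf_c_measurable : forall t : R, measurable_fun [set: Omega] (c t) ;
  rtf_front : {ae P, forall w, front_at theta a u Phi c w} }.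

End Front.

(* Main.v *)
Require Import Defs.
From mathcomp Require Import ring lra.

Set Implicit Arguments.
Unset Strict Implicit.
Unset Printing Implicit Defensive.

(** Fix a sample w and write al(t) = a(theta_t w), I(t) for its primitive
    vanishing at 0, G(lam) = e^lam + e^(-lam) - 2, U for the front and v for
    the perturbed solution.  The linearisation at 0 has the exact solutions
    P_lam(t, i) = exp(- lam i + G(lam) t + I(t)); the front follows P_mu, and
    xi = i - C(t), C(t) = (G(mu) t + I(t)) / mu, is the moving coordinate in
    which P_mu = e^(- mu xi).

    The reason for stability is that a perturbation which is negligible with
    respect to P_mu at the right end is dominated by P_nu for some nu slightly
    larger than mu, and that P_nu travels more slowly: since mu < mustar,
    convexity of G gives speed nu a_low < speed mu a_low
    ([slower_exponent]), hence P_nu / P_mu decays exponentially in time at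
    fixed xi.  Both (1 - e) U - M P_nu and (1 + e) U + M P_nu are barriers for
    the nonlinear equation, so they enclose v for all times ([sandwich]).

    To turn this into a relative estimate one needs U >= del P_mu ahead of the
    front, uniformly in time ([front_lower_bound]); the asymptotics of U are
    only known for each time separately.  The bound is propagated from time 0
    by the subsolution (P_mu - D e^L P_nu) / 2.  Because al has a lower bound
    only on average, the exponent L has to be corrected by a bounded function,
    a moving average of a primitive ([corrector]).  The result is
    (1 - e) U <= v <= (1 + e) U on xi >= - K for large times ([close_ahead]).

    Behind the front, U is at least 1/2 and the reaction term pulls v towards
    U: y(t) U is a sub- or supersolution there as soon as y relaxes to
    1 - e or 1 + e at a rate proportional to al, while ahead of the front the
    previous step already gives the comparison.  Since the integral of al
    diverges, y converges ([solution_eventually_ge],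
    [solution_eventually_le]).

    Every comparison rests on a maximum principle for the lattice Laplacian
    with locally bounded data ([lattice_max_principle], [kpp_comparison]). *)

(** * Derivatives of pointwise expressions *)

Section PointwiseDerivatives.
Context {R : realType}.
Implicit Types (f g : R -> R) (x k df dg : R).

(** Each rule is stated for a function given by an explicit body, so that the
    syntax of the body determines which rule applies. *)
Lemma is_derive_const k x : is_derive x 1 (fun=> k : R) 0.
Proof. exact: is_derive_cst. Qed.

Lemma is_derive_var x : is_derive x 1 (fun y : R => y) 1.
Proof. exact: is_derive_id. Qed.

Lemma is_derive_opp f x df :
  is_derive x 1 f df -> is_derive x 1 (fun y => - f y) (- df).
Proof. by move=> ?; exact: is_deriveN. Qed.

Lemma is_derive_add f g x df dg : is_derive x 1 f df -> is_derive x 1 g dg ->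
  is_derive x 1 (fun y => f y + g y) (df + dg).
Proof. by move=> ? ?; exact: is_deriveD. Qed.

Lemma is_derive_mul f g x df dg : is_derive x 1 f df -> is_derive x 1 g dg ->
  is_derive x 1 (fun y => f y * g y) (df * g x + f x * dg).
Proof.
move=> fd gd; rewrite addrC [df * _]mulrC.
exact: (is_deriveM fd gd).
Qed.

Lemma is_derive_exp f x df : is_derive x 1 f df ->
  is_derive x 1 (fun y => expR (f y)) (expR (f x) * df).
Proof. by move=> ?; exact: is_derive1_comp. Qed.

Lemma is_derive_pow f n x df : is_derive x 1 f df ->
  is_derive x 1 (fun y => f y ^+ n) (n%:R * f x ^+ n.-1 * df).
Proof.
by move=> fd; rewrite -[fun y => _]exprfctE; exact: is_deriveX.
Qed.

Lemma is_derive_continuous f x df : is_derive x 1 f df ->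
  {for x, continuous f}.
Proof. by move=> fx; exact/differentiable_continuous/derivable1_diffP. Qed.

Lemma is_derive_within_continuous f (df : R -> R) s t :
  (forall x, s <= x -> x <= t -> is_derive x 1 f (df x)) ->
  {within `[s, t], continuous f}.
Proof.
move=> fd; apply: derivable_within_continuous => x.
by rewrite in_itv/= => /andP[sx xt]; have [] := fd _ sx xt.
Qed.

End PointwiseDerivatives.

(** Differentiates the body of a function structurally; hypotheses on atomic
    functions are taken from the context. *)
Ltac derivative_rules := first
  [ notypeclasses refine (is_derive_const _ _)
  | notypeclasses refine (is_derive_var _)
  | solve [eauto 2 with nocore]
  | notypeclasses refine (is_derive_opp _); derivative_rules
  | notypeclasses refine (is_derive_add _ _); derivative_rules
  | notypeclasses refine (is_derive_mul _ _); derivative_rules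
  | notypeclasses refine (is_derive_exp _); derivative_rules
  | notypeclasses refine (is_derive_pow _ _); derivative_rules ].

Ltac compute_derivative :=
  notypeclasses refine (is_derive_eq _ _); [derivative_rules | cbn beta].

(** * Maximum and comparison principles on the lattice *)

Section Comparison.
Context {R : realType}.
Implicit Types (s t M b : R) (i : int).

(** Only the sign of the derivative where h is positive matters: from the last
    time at which h <= 0 on, h would be nonincreasing. *)
Lemma le0_of_derive_le0 (h dh : R -> R) t0 t1 :
  {within `[t0, t1], continuous h} -> h t0 <= 0 ->
  (forall t, t0 < t -> t < t1 -> 0 < h t ->
     is_derive t 1 h (dh t) /\ dh t <= 0) ->
  forall t, t0 <= t -> t <= t1 -> h t <= 0.
Proof.
move=> hc h0 hd t t0t tt1; rewrite leNgt; apply/negP => ht.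
have hct : {within `[t0, t], continuous h}.
  by apply: continuous_subspaceW hc; apply: subset_itvl; rewrite bnd_simp.
pose S := `[t0, t] `&` [set s | h s <= 0].
have S0 : S t0 by split => //=; rewrite in_itv /= lexx.
have Sub : has_ubound S by exists t => s [] /=; rewrite in_itv/= => /andP[].
have Sne : S !=set0 by exists t0.
have [t0s st hs] : [/\ t0 <= sup S, sup S <= t & h (sup S) <= 0].
  suff [] : S (sup S) by rewrite /= in_itv/= => /andP[].
  have clS : closed S.
    rewrite /S setIC (@closed_setIS R `[t0, t] _ (@itv_closed _ _ _ _)).
    exact: (continuous_closedP _).1 hct _ (@closed_le _ 0).
  by have := closure_sup Sne Sub; rewrite -((closure_id _).1 clS).
set s := sup S in t0s st hs.
have slt : s < t.
  by rewrite lt_neqAle st andbT; apply: contraTneq ht => <-; rewrite -leNgt.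
have hpos x : s < x -> x < t -> 0 < h x.
  move=> sx xt; rewrite ltNge; apply/negP => hx.
  suff : x <= s by rewrite leNgt sx.
  apply: ub_le_sup => //; split => //=.
  by rewrite in_itv/= (ltW xt) (le_trans t0s (ltW sx)).
have hx x : x \in `]s, t[ -> is_derive x 1 h (dh x) /\ dh x <= 0.
  rewrite in_itv/= => /andP[sx xt].
  by apply: hd; [exact: le_lt_trans sx | exact: lt_le_trans tt1 | exact: hpos].
have hcs : {within `[s, t], continuous h}.
  by apply: continuous_subspaceW hct; apply: subset_itvr; rewrite bnd_simp.
have [c cst hE] := MVT slt (fun x xst => (hx x xst).1) hcs.
suff : h t - h s <= 0 by lra.
by rewrite hE mulr_le0_ge0 ?(hx c cst).2// subr_ge0.
Qed.

(** Gronwall iteration.  At a point where z is positive, the right-hand side is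
    at most (2 + b) times any nonnegative bound for z at that time, so a bound
    by N ((2 + b) (t - t0))^n / n!, where N = max(M, 0), improves to the next
    such term; the terms of the exponential series tend to 0.  The upper bound M
    starts the iteration and replaces compactness of the lattice. *)
Lemma lattice_max_principle (z dz : R -> int -> R) t0 t1 M b :
  0 <= b ->
  (forall i, {within `[t0, t1], continuous (z ^~ i)}) ->
  (forall t i, t0 <= t -> t <= t1 -> z t i <= M) ->
  (forall i, z t0 i <= 0) ->
  (forall t i, t0 < t -> t < t1 -> 0 < z t i ->
     is_derive t 1 (z ^~ i) (dz t i) /\
     dz t i <= z t (i + 1) - 2 * z t i + z t (i - 1) + b * z t i) ->
  forall t i, t0 <= t -> t <= t1 -> z t i <= 0.
Proof.
move=> b0 zc zM z0 hz t i t0t tt1.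
pose N := Num.max M 0.
have N0 : 0 <= N by rewrite /N le_max lexx orbT.
pose m n s : R := N * exp_coeff ((2 + b) * (s - t0)) n.
have m0 n s : t0 <= s -> 0 <= m n s.
  move=> t0s; apply: mulr_ge0 => //; apply: exp_coeff_ge0.
  by apply: mulr_ge0; lra.
have key n : forall s j, t0 <= s -> s <= t1 -> z s j <= m n s.
  elim: n => [s j t0s st1|n IH s j t0s st1].
    rewrite /m /exp_coeff/= expr0 divr1 mulr1 (le_trans (zM _ _ t0s st1))//.
    by rewrite le_max lexx.
  have dm (x : R) : is_derive x 1 (m n.+1) ((2 + b) * m n x).
    rewrite /m /exp_coeff/=.
    compute_derivative.
    rewrite /= factS natrM !(mul0r, mulr0, subr0, addr0, add0r, mulr1).
    have n0 : n.+1%:R != 0 :> R by rewrite pnatr_eq0.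
    have f0 : n`!%:R != 0 :> R by rewrite pnatr_eq0 -lt0n fact_gt0.
    move: (_ ^+ n) n.+1%:R n`!%:R n0 f0 => X k l k0 l0.
    by field; rewrite l0 k0.
  pose h x := z x j - m n.+1 x.
  suff : h s <= 0 by rewrite subr_le0.
  apply: (@le0_of_derive_le0 h (fun x => dz x j - (2 + b) * m n x) t0 t1) => //.
  - apply: within_continuousB; first exact: zc.
    by apply: is_derive_within_continuous => y _ _; exact: dm.
  - by rewrite /h subr_le0 (le_trans (z0 _))// m0.
  - move=> x t0x xt1 hx.
    have zx : 0 < z x j by have := m0 n.+1 x (ltW t0x); rewrite /h in hx; lra.
    have [zd dzle] := hz _ _ t0x xt1 zx.
    split; first exact: is_deriveB.
    have b1 := IH x (j + 1) (ltW t0x) (ltW xt1).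
    have b2 := IH x (j - 1) (ltW t0x) (ltW xt1).
    have b3 := IH x j (ltW t0x) (ltW xt1).
    have b4 := ler_wpM2l b0 b3.
    rewrite mulrDl; lra.
have cm : m ^~ t @ \oo --> 0.
  rewrite -(mulr0 N); apply: cvgM; first exact: cvg_cst.
  exact: cvg_exp_coeff.
apply: (@ler_cvg_to _ _ _ _ (fun=> z t i) _ (z t i) 0 (cvg_cst _) cm).
by near=> n; exact: key.
Unshelve. all: by end_near. Qed.

(** The difference z = w - v satisfies the maximum principle because
    w (1 - w) - v (1 - v) = z (1 - w - v), whose last factor is bounded above
    where w > v >= - M.  The differential inequalities are asked for only where
    w > v: barriers are often barriers only on part of the lattice. *)
Lemma kpp_comparison (al : R -> R) (w v dw dv : R -> int -> R) t0 t1 A M :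
  0 <= M ->
  (forall t, t0 <= t -> t <= t1 -> 0 <= al t <= A) ->
  (forall i, {within `[t0, t1], continuous (w ^~ i)}) ->
  (forall i, {within `[t0, t1], continuous (v ^~ i)}) ->
  (forall t i, t0 <= t -> t <= t1 -> w t i <= M) ->
  (forall t i, t0 <= t -> t <= t1 -> - M <= v t i) ->
  (forall t i, t0 < t -> t < t1 -> v t i < w t i ->
     [/\ is_derive t 1 (w ^~ i) (dw t i), is_derive t 1 (v ^~ i) (dv t i),
         dw t i <= kpp (al t) (w t) i & kpp (al t) (v t) i <= dv t i]) ->
  (forall i, w t0 i <= v t0 i) ->
  forall t i, t0 <= t -> t <= t1 -> w t i <= v t i.
Proof.
move=> M0 alA wc vc wM vM dwv wv0 t i t0t tt1.
pose z s j := w s j - v s j.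
suff : z t i <= 0 by rewrite subr_le0.
have A0 : 0 <= A by have /andP[/le_trans] := alA _ t0t tt1; apply.
apply: (@lattice_max_principle z (fun s j => dw s j - dv s j) t0 t1
  (M + M) (A * (1 + M + M))) => //.
- by apply: mulr_ge0 => //; lra.
- by move=> j; apply: within_continuousB.
- by move=> s j s0 s1; rewrite /z; have := wM s j s0 s1; have := vM s j s0 s1; lra.
- by move=> j; rewrite subr_le0.
- move=> s j s0 s1; rewrite subr_gt0 => vw.
  have [wd vd wle vge] := dwv _ _ s0 s1 vw.
  split; first exact: is_deriveB.
  have /andP[al0 alle] := alA _ (ltW s0) (ltW s1).
  have vm := vM s j (ltW s0) (ltW s1).
  have zz : 0 < z s j by rewrite subr_gt0.
  have h1 : al s * (z s j * (1 - w s j - v s j)) <= al s * (z s j * (1 + M + M)).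
    by apply: ler_wpM2l => //; apply: ler_wpM2l; [exact: ltW|lra].
  have h2 : al s * (z s j * (1 + M + M)) <= A * (z s j * (1 + M + M)).
    by apply: ler_wpM2r => //; apply: mulr_ge0; [exact: ltW|lra].
  rewrite /kpp in wle vge.
  have e1 : al s * w s j * (1 - w s j) - al s * v s j * (1 - v s j)
            = al s * (z s j * (1 - w s j - v s j)) by rewrite /z; ring.
  have e2 : A * (1 + M + M) * z s j = A * (z s j * (1 + M + M)) by ring.
  rewrite e2 /z; rewrite /z in h1 h2 e1; lra.
Qed.

End Comparison.

(** * Oriented integrals and mean values *)

Section Integrals.
Context {R : realType}.
Implicit Types (f : R -> R) (s t r : R).
Notation leb := (@lebesgue_measure R).

Lemma locally_hoelder_continuous f : locally_hoelder f -> continuous f.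
Proof.
move=> hf t0; have [al [C [al0 _ [U Ut0 hU]]]] := hf t0.
apply/cvgrPdist_le => /= e e0.
pose K := `|C| + 1.
have K0 : 0 < K by rewrite ltr_wpDl.
pose d := (e / K) `^ al^-1.
have d0 : 0 < d by rewrite powR_gt0// divr_gt0.
near=> t.
have Ut : U t by near: t.
have Utt : U t0 by exact: nbhs_singleton.
apply: le_trans (hU _ _ Utt Ut) _.
have td : `|t0 - t| <= d.
  near: t; exact: (@cvgr_dist_le _ _ _ _ _ id t0).
apply: (@le_trans _ _ (K * d `^ al)).
  apply: (@le_trans _ _ (K * `|t0 - t| `^ al)).
    by apply: ler_wpM2r; [exact: powR_ge0 | rewrite /K; have := ler_norm C; lra].
  apply: ler_wpM2l; first exact: ltW.
  by rewrite ge0_ler_powR ?nnegrE// ltW.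
rewrite /d -powRrM mulVf ?gt_eqF// powRr1; last by rewrite ltW// divr_gt0.
by rewrite mulrC divfK// gt_eqF.
Unshelve. all: by end_near. Qed.

Lemma continuous_integrable f s t : continuous f ->
  leb.-integrable `[s, t] (EFin \o f).
Proof.
move=> fc; apply: (@continuous_compact_integrable R f _ (@segment_compact _ s t)).
exact: continuous_subspaceT.
Qed.

Lemma ointB f s t : continuous f -> oint f s t = oint f 0 t - oint f 0 s.
Proof.
(* All integrals are split at a point b to the left of 0, s and t. *)
move=> fc; pose b := Num.min 0 (Num.min s t).
have b0 : b <= 0 by rewrite ge_min lexx.
have bs : b <= s by rewrite !ge_min lexx orbT.
have bt : b <= t by rewrite !ge_min lexx !orbT.
pose F x := \int[leb]_(y in `[b, x]) f y.
have split x y : b <= x -> x <= y -> \int[leb]_(z in `[x, y]) f z = F y - F x.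
  move=> bx xy; rewrite /F Rintegral_itvB ?bnd_simp//; last first.
    exact: continuous_integrable.
  rewrite Rintegral_itv_obnd_cbnd//.
  apply: (@integrableS _ _ _ leb `[x, y]) => //; last exact: continuous_integrable.
  by apply: subset_itvr; rewrite bnd_simp.
have ointF x y : b <= x -> b <= y -> oint f x y = F y - F x.
  move=> bx by_; rewrite /oint; case: leP => [xy|/ltW yx]; first exact: split.
  by rewrite split// opprB.
by rewrite !ointF//; ring.
Qed.

Lemma oint_refl f s : continuous f -> oint f s s = 0.
Proof. by move=> fc; rewrite ointB// subrr. Qed.

Lemma is_derive_oint f t : continuous f ->
  is_derive t 1 (fun x => oint f 0 x) (f t).
Proof.
(* Integrating from a point b < t makes t interior to the domain. *)
move=> fc; pose b := Num.min 0 t - 1.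
have b0 : b < 0.
  by rewrite /b; have : Num.min 0 t <= 0 by [rewrite ge_min lexx]; lra.
have bt : b < t.
  by rewrite /b; have : Num.min 0 t <= t by [rewrite ge_min lexx orbT]; lra.
apply: (@near_eq_is_derive _ _ _ (fun x => oint f b x - oint f b 0)).
  near=> x; rewrite (ointB b x)// (ointB b 0)// oint_refl//; ring.
have -> : f t = f t - 0 by rewrite subr0.
apply: is_deriveB.
apply: (@near_eq_is_derive _ _ _ (fun x => \int[leb]_(y in `[b, x]) f y)).
  near=> x; have bx : b <= x by near: x; exact: lt_le_nbhsr.
  by rewrite /oint bx.
have [|//|d1 d2] := @continuous_FTC1_closed R f b t (t + 1) _ _ bt (fc t).
- by lra.
- exact: continuous_integrable.
by rewrite -d2 derive1E; exact: derivableP.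
Unshelve. all: by end_near. Qed.

(** The infimum of the averages over intervals of length at least r is
    nondecreasing in r, so its limit is a supremum and any l < m is exceeded
    for some r. *)
Lemma lower_mean_ge f m l : continuous f -> lower_mean f = m%:E -> l < m ->
  exists2 r, 0 < r &
    forall s t, r <= t - s -> l * (t - s) <= oint f 0 t - oint f 0 s.
Proof.
move=> fc fm lm.
have : lower_mean f = ereal_sup (range (fun r => ereal_inf (averages f r))).
  apply: cvg_lim => //; apply: nondecreasing_cvge => r1 r2 r12.
  apply: ereal_inf_le_tmp => _ [s [t [r2ts ->]]].
  by exists s, t; split => //; exact: le_trans r2ts.
rewrite fm => supE.
have : (l%:E < ereal_sup (range (fun r => ereal_inf (averages f r))))%E.
  by rewrite -supE lte_fin.
move=> /ereal_sup_gt[_ [r _ <-]] lr.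
exists (Num.max r 1); first by rewrite lt_max ltr01 orbT.
move=> s t; rewrite ge_max => /andP[rts ts1].
have ts0 : 0 < t - s by lra.
have : (ereal_inf (averages f r) <= ((t - s)^-1 * oint f s t)%:E)%E.
  by apply: ereal_inf_lbound; exists s, t.
move=> /(lt_le_trans lr); rewrite lte_fin -ointB// => /ltW.
by rewrite mulrC ler_pdivlMr.
Qed.

Lemma upper_mean_le f m l : continuous f -> upper_mean f = m%:E -> m < l ->
  exists2 r, 0 < r &
    forall s t, r <= t - s -> oint f 0 t - oint f 0 s <= l * (t - s).
Proof.
move=> fc fm lm.
have : upper_mean f = ereal_inf (range (fun r => ereal_sup (averages f r))).
  apply: cvg_lim => //; apply: nonincreasing_cvge => r1 r2 r12.
  apply: ereal_sup_le => _ [s [t [r2ts ->]]].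
  by exists s, t; split => //; exact: le_trans r2ts.
rewrite fm => infE.
have : (ereal_inf (range (fun r => ereal_sup (averages f r))) < l%:E)%E.
  by rewrite -infE lte_fin.
move=> /ereal_inf_lt[_ [r _ <-]] lr.
exists (Num.max r 1); first by rewrite lt_max ltr01 orbT.
move=> s t; rewrite ge_max => /andP[rts ts1].
have ts0 : 0 < t - s by lra.
have : (((t - s)^-1 * oint f s t)%:E <= ereal_sup (averages f r))%E.
  by apply: ereal_sup_ubound; exists s, t.
move=> /le_lt_trans /(_ lr); rewrite lte_fin -ointB// => /ltW.
by rewrite mulrC ler_pdivrMr.
Qed.

End Integrals.

(** * The dispersion relation *)

Section Dispersion.
Context {R : realType}.
Implicit Types (lam mu nu b x y z : R).

(** The eigenvalue of the lattice Laplacian on the exponential e^(- lam i). *)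
Definition dispersion lam : R := expR lam + expR (- lam) - 2.

Lemma speedE lam b : speed lam b = (dispersion lam + b) / lam.
Proof. by []. Qed.

Lemma dispersion_gt0 lam : 0 < lam -> 0 < dispersion lam.
Proof.
move=> lam0; rewrite /dispersion expRN.
set e := expR lam; have e1 : 1 < e by rewrite expR_gt1.
have -> : e + e^-1 - 2 = (e - 1) ^+ 2 / e by field; lra.
by rewrite divr_gt0 ?exprn_gt0//; lra.
Qed.

Lemma expR_tangent x y : expR y * (1 + (x - y)) <= expR x.
Proof.
rewrite -{2}(subrK y x) expRD mulrC ler_wpM2r ?expR_ge0//.
exact: expR_ge1Dx.
Qed.

Lemma expR_chord x y z : x <= y -> y <= z ->
  (z - x) * expR y <= (z - y) * expR x + (y - x) * expR z.
Proof.
move=> xy yz.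
have h1 : (z - y) * (expR y * (1 + (x - y))) <= (z - y) * expR x.
  by rewrite ler_wpM2l ?subr_ge0// expR_tangent.
have h2 : (y - x) * (expR y * (1 + (z - y))) <= (y - x) * expR z.
  by rewrite ler_wpM2l ?subr_ge0// expR_tangent.
have -> : (z - x) * expR y = (z - y) * (expR y * (1 + (x - y))) +
  (y - x) * (expR y * (1 + (z - y))) by ring.
lra.
Qed.

Lemma dispersion_chord x y z : x <= y -> y <= z ->
  (z - x) * dispersion y <= (z - y) * dispersion x + (y - x) * dispersion z.
Proof.
move=> xy yz; have := expR_chord xy yz.
have := @expR_chord (- z) (- y) (- x); rewrite !lerN2 => /(_ yz xy).
rewrite /dispersion; lra.
Qed.

Lemma expR_midpoint x y : x != y -> 2 * expR ((x + y) / 2) < expR x + expR y.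
Proof.
move=> xy.
have -> : (x + y) / 2 = x / 2 + y / 2 by field.
have ee z : expR z = expR (z / 2) * expR (z / 2).
  by rewrite -expRD; congr expR; field.
rewrite expRD (ee x) (ee y).
have : 0 < (expR (x / 2) - expR (y / 2)) ^+ 2.
  rewrite exprn_even_gt0//= subr_eq0; apply: contra xy => /eqP/expR_inj h.
  by apply/eqP; lra.
lra.
Qed.

Lemma dispersion_midpoint x y : x != y ->
  2 * dispersion ((x + y) / 2) < dispersion x + dispersion y.
Proof.
move=> xy; have := expR_midpoint xy.
have := @expR_midpoint (- x) (- y); rewrite eqr_opp => /(_ xy).
have -> : (- x + - y) / 2 = - ((x + y) / 2) by field.
rewrite /dispersion; lra.
Qed.

Lemma minimal_speed_le b lam : 0 < b -> 0 < lam ->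
  minimal_speed b <= speed lam b.
Proof.
move=> b0 lam0; apply: ge_inf; last by exists lam.
exists 0 => _ [x /= x0 <-]; rewrite speedE divr_ge0 ?ltW//.
by rewrite ltr_wpDr ?dispersion_gt0// ltW.
Qed.

(** The convex function H = dispersion + b lies above the line c0 lam, where c0
    is the minimal speed, touches it at mustar, and by strict convexity is
    strictly above it at mu.  Along the chord from mu to mustar the slope
    H(lam) / lam therefore drops below H(mu) / mu immediately, and any nu in
    (mu, mustar] serves; nu <= 2 mu is what absorbs the quadratic term of the
    equation in [front_tail]. *)
Lemma slower_exponent mustar mu b :
  0 < b -> minimal_speed b = speed mustar b -> 0 < mu -> mu < mustar ->
  exists2 nu, mu < nu <= 2 * mu &
    0 < nu / mu * (dispersion mu + b) - (dispersion nu + b).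
Proof.
move=> b0 minE mu0 mulam.
have ms0 : 0 < mustar by lra.
set c0 := speed mustar b.
have c0E : dispersion mustar + b = c0 * mustar.
  by rewrite /c0 speedE divfK// gt_eqF.
have c0le x : 0 < x -> c0 * x <= dispersion x + b.
  move=> x0; have := minimal_speed_le b0 x0.
  by rewrite minE -/c0 speedE ler_pdivlMr.
have c0lt : c0 * mu < dispersion mu + b.
  rewrite ltNge; apply/negP => le0.
  have : mu != mustar by rewrite lt_eqF.
  move=> /dispersion_midpoint.
  have : c0 * ((mu + mustar) / 2) <= dispersion ((mu + mustar) / 2) + b.
    by apply: c0le; lra.
  lra.
pose nu := Num.min mustar (2 * mu).
have nums : nu <= mustar by rewrite ge_min lexx.
have nu2 : nu <= 2 * mu by rewrite ge_min lexx orbT.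
have munu : mu < nu by rewrite lt_min mulam/=; lra.
exists nu; first by rewrite munu.
have := dispersion_chord (ltW munu) nums.
set Hm := dispersion mu in c0lt *; set Hn := dispersion nu.
have -> : dispersion mustar = c0 * mustar - b by lra.
move=> ch.
have -> : nu / mu * (Hm + b) - (Hn + b) = (nu * (Hm + b) - mu * (Hn + b)) / mu.
  by field; lra.
rewrite divr_gt0// -(pmulr_rgt0 _ (_ : 0 < mustar - mu)); last by lra.
have k1 : 0 < mustar * ((nu - mu) * (Hm + b - c0 * mu)).
  by apply: mulr_gt0 => //; apply: mulr_gt0; lra.
have := ler_wpM2l (ltW mu0) ch.
lra.
Qed.

End Dispersion.

(** * The front and its perturbations in a fixed medium *)

Section Medium.
Context {R : realType}.
Implicit Types (s t x lam : R) (i : int).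

(** A single realisation: al is the reaction rate along a trajectory of the
    flow and I its primitive. *)
Variables (al I : R -> R).
Hypothesis al_gt0 : forall t, 0 < al t.
Hypothesis al_cont : continuous al.
Hypothesis dI : forall t, is_derive t 1 I (al t).
Hypothesis I0 : I 0 = 0.

Lemma mean_value (f df : R -> R) s t : s <= t ->
  (forall x, is_derive x 1 f (df x)) ->
  exists2 x, s <= x <= t & f t - f s = df x * (t - s).
Proof.
move=> st fd; have [|x] := MVT_segment st (fun x _ => fd x).
  exact: (is_derive_within_continuous (fun x _ _ => fd x)).
by rewrite in_itv; exists x.
Qed.

Lemma primitive_mono s t : s <= t -> I s <= I t.
Proof.
move=> st; have [x _ e] := mean_value st dI.
by rewrite -subr_ge0 e mulr_ge0 ?subr_ge0// ltW.
Qed.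

Variables (Lam rup : R).
Hypothesis rup_gt0 : 0 < rup.
Hypothesis upper : forall s t, rup <= t - s -> I t - I s <= Lam * (t - s).

(** The rate itself may be unbounded; its integrals over intervals of bounded
    length are not. *)
Lemma primitive_increment_bounded (tau : R) :
  exists2 B, 0 <= B & forall s t, s <= t -> t - s <= tau -> I t - I s <= B.
Proof.
have rup0 := rup_gt0; pose T : R := Num.max tau rup.
have Trup : rup <= T by rewrite le_max lexx orbT.
have Ttau : tau <= T by rewrite le_max lexx.
exists (Lam * T).
  have : I T - I 0 <= Lam * (T - 0) by apply: upper; rewrite subr0.
  have : I 0 <= I T by apply: primitive_mono; lra.
  rewrite subr0; lra.
move=> s t st tst.
have : I (s + T) - I s <= Lam * (s + T - s).
  by apply: upper; rewrite addrC addKr.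
have : I t <= I (s + T) by apply: primitive_mono; lra.
have -> : s + T - s = T by ring.
lra.
Qed.

Variables (lo rlo : R).
Hypothesis lo_gt0 : 0 < lo.
Hypothesis rlo_gt0 : 0 < rlo.
Hypothesis lower : forall s t, rlo <= t - s -> lo * (t - s) <= I t - I s.

(** The linear combination p + q al is positive only on average.  Writing
    q = q' + kap with p + q' lo >= 0, the moving average of the primitive J of
    p + q' al over a window of length rlo differs from J by a bounded function
    and has the nonnegative derivative (J(t + rlo) - J(t)) / rlo; adding kap I
    gives a function L whose derivative dominates kap al pointwise. *)
Lemma corrector (p q : R) : 0 < q -> 0 < p + q * lo ->
  exists (L dL : R -> R) (kap B : R),
  [/\ 0 < kap, forall t, is_derive t 1 L (dL t),
      forall t, kap * al t <= dL t &
      forall t, 0 <= L t - (p * t + q * I t) <= B].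
Proof.
move=> q0 pq; have lo0 := lo_gt0.
pose kap : R := Num.min q ((p + q * lo) / lo).
have kap0 : 0 < kap by rewrite lt_min q0 divr_gt0.
have kapq : kap <= q by rewrite ge_min lexx.
have kaplo : kap * lo <= p + q * lo.
  by rewrite -ler_pdivlMr// ge_min lexx orbT.
pose q' := q - kap.
have q'0 : 0 <= q' by rewrite subr_ge0.
have pq' : 0 <= p + q' * lo by rewrite /q' mulrBl; lra.
pose J x := p * x + q' * I x.
have dJ t : is_derive t 1 J (p + q' * al t).
  by rewrite /J; compute_derivative; ring.
have Jc : continuous J by move=> t; exact: is_derive_continuous (dJ t).
pose K x := oint J 0 x.
have dK t : is_derive t 1 K (J t) by exact: is_derive_oint.
pose T := rlo.
have T0 : 0 < T := rlo_gt0.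
have dKT t : is_derive t 1 (fun x => K (x + T)) (J (t + T)).
  rewrite -[J _]mulr1; apply: (@is_derive1_comp _ K (fun x => x + T)).
  by compute_derivative; rewrite addr0.
pose L x := kap * I x + `|p| * T + (K (x + T) - K x) / T.
have [B B0 HB] := primitive_increment_bounded T.
exists L, (fun t => kap * al t + (J (t + T) - J t) / T), kap.
exists (`|p| * T + `|p| * T + q' * B).
split => //.
- by move=> t; rewrite /L; compute_derivative; ring.
- move=> t; rewrite lerDl divr_ge0 ?(ltW T0)// /J.
  have : lo * (t + T - t) <= I (t + T) - I t.
    by apply: lower; rewrite addrC addKr.
  have -> : t + T - t = T by ring.
  move=> /(ler_wpM2l q'0) h.
  have : 0 <= (p + q' * lo) * T by rewrite mulr_ge0// ltW.
  lra.
- move=> t.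
  have tT : t <= t + T by lra.
  have [x /andP[tx xT] e] := mean_value tT dK.
  have -> : L t - (p * t + q * I t) = `|p| * T + p * (x - t) + q' * (I x - I t).
    rewrite /L e /J /q'; field; lra.
  have p1 : `|p * (x - t)| <= `|p| * T.
    by rewrite normrM ler_wpM2l// ger0_norm; lra.
  move: p1; rewrite ler_norml => /andP[p1 p2].
  have i1 : 0 <= q' * (I x - I t) by rewrite mulr_ge0// subr_ge0 primitive_mono.
  have i2 : q' * (I x - I t) <= q' * B.
    by rewrite ler_wpM2l// HB//; lra.
  lra.
Qed.

(** The solution of the equation linearised at 0 with profile e^(- lam i). *)
Definition tail_wave lam t i : R :=
  expR (- lam * i%:~R + dispersion lam * t + I t).

Lemma tail_wave_gt0 lam t i : 0 < tail_wave lam t i.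
Proof. exact: expR_gt0. Qed.

Lemma is_derive_tail_wave lam t i :
  is_derive t 1 (tail_wave lam ^~ i) ((dispersion lam + al t) * tail_wave lam t i).
Proof. by rewrite /tail_wave; compute_derivative; ring. Qed.

Lemma tail_wave_laplacian lam t i :
  tail_wave lam t (i + 1) - 2 * tail_wave lam t i + tail_wave lam t (i - 1) =
  dispersion lam * tail_wave lam t i.
Proof.
have e (d : int) :
    tail_wave lam t (i + d) = tail_wave lam t i * expR (- lam * d%:~R).
  by rewrite /tail_wave -expRD intrD; congr expR; ring.
rewrite !e /dispersion.
have -> : - lam * (1 : int)%:~R = - lam by rewrite mulr1.
have -> : - lam * (- 1 : int)%:~R = lam by rewrite mulrN1z; ring.
ring.
Qed.

Lemma al_bounded t0 t1 : exists A,
  forall t, t0 <= t -> t <= t1 -> 0 <= al t <= A.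
Proof.
have [t10|t01] := ltP t1 t0.
  by exists 0 => t t0t tt1; exfalso; lra.
have [c _ hc] := EVT_max t01 (continuous_subspaceT al_cont).
by exists (al c) => t t0t tt1; rewrite (ltW (al_gt0 t)) hc// in_itv/= t0t.
Qed.

Variables (mu nu : R).
Hypothesis mu_gt0 : 0 < mu.
Hypothesis mu_nu : mu < nu.
Hypothesis nu_le : nu <= 2 * mu.
(** The lag of [tail_wave nu] behind [tail_wave mu] at time t is
    (p t + q I(t)) / nu. *)
Let p := nu / mu * dispersion mu - dispersion nu.
Let q := nu / mu - 1.
Hypothesis drift : 0 < p + q * lo.

(** The point where [tail_wave mu] takes the value 1. *)
Definition front_position t := (dispersion mu * t + I t) / mu.

Notation C := front_position.

Lemma drift_q_gt0 : 0 < q.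
Proof. by rewrite /q subr_gt0 ltr_pdivlMr// mul1r. Qed.

Lemma tail_wave_mu t i : tail_wave mu t i = expR (- mu * (i%:~R - C t)).
Proof.
by have mu0 := mu_gt0; rewrite /tail_wave /C; congr expR; field; lra.
Qed.

Lemma tail_wave_nu t i :
  tail_wave nu t i = expR (- nu * (i%:~R - C t)) * expR (- (p * t + q * I t)).
Proof.
have mu0 := mu_gt0.
by rewrite /tail_wave /C -expRD /p /q; congr expR; field; lra.
Qed.

(** The last factor decays exponentially in time: this is the speed deficit
    of the faster decaying wave. *)
Lemma tail_wave_ratio t i : tail_wave nu t i =
  tail_wave mu t i * expR (- (nu - mu) * (i%:~R - C t)) *
  expR (- (p * t + q * I t)).
Proof. by rewrite tail_wave_nu tail_wave_mu -!expRD; congr expR; ring. Qed.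

Lemma front_position_advance s t : s <= t ->
  dispersion mu / mu * (t - s) <= C t - C s.
Proof.
move=> st; have mu0 := mu_gt0; rewrite /C.
have -> : (dispersion mu * t + I t) / mu - (dispersion mu * s + I s) / mu =
  dispersion mu / mu * (t - s) + (I t - I s) / mu by field; lra.
by rewrite lerDl divr_ge0 ?subr_ge0 ?primitive_mono// ltW.
Qed.

Variable U : R -> int -> R.
Hypothesis U_solution : entire_solution al U.
Hypothesis U_bounds : forall t i, 0 < U t i < 1.
Variable n0 : int.
Hypothesis U0_tail : forall i, n0 <= i -> tail_wave mu 0 i / 2 <= U 0 i.

Lemma U_within_continuous s t i : {within `[s, t], continuous (U ^~ i)}.
Proof. exact: (is_derive_within_continuous (fun x _ _ => U_solution x i)). Qed.

(** Where w = (P_mu - D e^L P_nu) / 2 is positive one has xi > 0, hence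
    w^2 <= P_mu^2 / 4 <= e^(- nu xi) / 4 by nu <= 2 mu, and the quadratic term
    al w^2 is paid for by the derivative of L once D kap >= 1.  A large D also
    makes w nonpositive at time 0 to the left of n0. *)
Lemma front_tail : exists X : R, forall t i, 0 <= t -> X <= i%:~R - C t ->
  tail_wave mu t i / 4 <= U t i.
Proof.
have mu0 := mu_gt0; have munu := mu_nu; have nu2 := nu_le.
have [L [dL [kap [B [kap0 dLd dLge LB]]]]] := corrector drift_q_gt0 drift.
pose D := 1 + kap^-1 + expR ((nu - mu) * n0%:~R).
have ik0 : 0 < kap^-1 by rewrite invr_gt0.
have en0 := expR_ge0 ((nu - mu) * n0%:~R).
have D1 : 1 <= D by rewrite /D; lra.
have D0 : 0 < D := lt_le_trans ltr01 D1.
have munu0 : 0 < nu - mu by rewrite subr_gt0.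
have Dkap : 1 <= D * kap.
  rewrite /D; set e := expR _ in en0 *; rewrite !mulrDl mulVf ?gt_eqF// mul1r.
  by have := mulr_ge0 en0 (ltW kap0); lra.
have Dn0 : expR ((nu - mu) * n0%:~R) <= D by rewrite /D; lra.
pose E t i := expR (L t) * tail_wave nu t i.
have E0 t i : 0 < E t i by rewrite mulr_gt0 ?expR_gt0.
have Ege t i : expR (- nu * (i%:~R - C t)) <= E t i.
  rewrite /E tail_wave_nu mulrCA -expRD ler_pMr ?expR_gt0//.
  by rewrite -expR0 ler_expR; have /andP[] := LB t; lra.
have Ele t i : E t i <= expR B * expR (- nu * (i%:~R - C t)).
  rewrite /E tail_wave_nu mulrCA [leRHS]mulrC ler_pM2l ?expR_gt0// -expRD ler_expR.
  by have /andP[] := LB t; lra.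
pose w t i := (tail_wave mu t i - D * E t i) / 2.
pose dw t i := ((dispersion mu + al t) * tail_wave mu t i -
  D * (dL t * E t i + (dispersion nu + al t) * E t i)) / 2.
have wd t i : is_derive t 1 (w ^~ i) (dw t i).
  have d1 := is_derive_tail_wave mu t i.
  have d2 := is_derive_tail_wave nu t i.
  rewrite /w /E /dw; compute_derivative; rewrite /E.
  by move: (tail_wave mu t i) (tail_wave nu t i) (expR (L t)) => x y z; field.
have w_pos t i : 0 < w t i ->
    [/\ 0 < i%:~R - C t, tail_wave mu t i <= 1 & (w t i) ^+ 2 <= E t i / 4].
  move=> w0; have : D * E t i < tail_wave mu t i by rewrite /w in w0; lra.
  have DE : E t i <= D * E t i by rewrite ler_peMl// ltW.
  move=> DEP; have : expR (- nu * (i%:~R - C t)) < expR (- mu * (i%:~R - C t)).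
    by rewrite -tail_wave_mu; have := Ege t i; lra.
  rewrite ltr_expR => h.
  have xi : 0 < i%:~R - C t.
    by rewrite -(pmulr_rgt0 _ munu0); lra.
  have P1 : tail_wave mu t i <= 1.
    rewrite tail_wave_mu -[leRHS]expR0 ler_expR mulNr oppr_le0.
    exact: (mulr_ge0 (ltW mu0) (ltW xi)).
  split => //.
  have P0 := tail_wave_gt0 mu t i.
  have wP : w t i <= tail_wave mu t i / 2 by rewrite /w; have := E0 t i; nra.
  apply: (@le_trans _ _ ((tail_wave mu t i / 2) ^+ 2)).
    by rewrite ler_sqr ?nnegrE ?(ltW w0)//; lra.
  rewrite expr_div_n (_ : 2 ^+ 2 = 4); last by ring.
  rewrite ler_pM2r//; apply: le_trans (Ege t i).
  rewrite tail_wave_mu -expRM_natl ler_expR.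
  have : 0 <= (2 * mu - nu) * (i%:~R - C t).
    by apply: mulr_ge0; [rewrite subr_ge0 | exact: ltW].
  lra.
have wU t i : 0 <= t -> w t i <= U t i.
  move=> t0; have [A alA] := al_bounded 0 t.
  apply: (@kpp_comparison _ al w U dw
    (fun s j => kpp (al s) (U s) j) 0 t A 1) => //.
  - move=> j; exact: (is_derive_within_continuous (fun x _ _ => wd x j)).
  - move=> j; exact: U_within_continuous.
  - move=> s j _ _; have [w0|w0] := ltP 0 (w s j); last lra.
    have [_ P1 _] := w_pos _ _ w0.
    by rewrite /w; have := E0 s j; nra.
  - by move=> s j _ _; have /andP[] := U_bounds s j; lra.
  - move=> s j s0 st Uw.
    have w0 : 0 < w s j by have /andP[] := U_bounds s j; lra.
    split => //.
    have [_ _ w2] := w_pos _ _ w0.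
    have -> : kpp (al s) (w s) j =
        dispersion mu * tail_wave mu s j / 2 -
        D * expR (L s) * (dispersion nu * tail_wave nu s j) / 2 +
        al s * w s j - al s * (w s j) ^+ 2.
      have l1 := tail_wave_laplacian mu s j.
      have l2 := tail_wave_laplacian nu s j.
      rewrite -l1 -l2 /kpp /w /E {l1 l2}.
      move: (tail_wave mu s) (tail_wave nu s) (expR (L s)) (al s) => f g x y.
      by field.
    have : al s * w s j ^+ 2 <= al s * (E s j / 4).
      by rewrite ler_wpM2l// ltW.
    have h3 : al s * E s j <= D * (dL s * E s j).
      have h4 : D * (kap * al s * E s j) <= D * (dL s * E s j).
        by apply: ler_wpM2l; [exact: ltW | apply: ler_wpM2r => //; exact: ltW].
      apply: le_trans h4.
      have -> : D * (kap * al s * E s j) = (D * kap) * (al s * E s j) by ring.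
      by rewrite ler_peMl// mulr_ge0// ltW.
    have h5 : 0 < al s * E s j by rewrite mulr_gt0.
    rewrite /dw /w -/(E s j).
    have -> : D * expR (L s) * (dispersion nu * tail_wave nu s j) =
      D * (dispersion nu * E s j) by rewrite /E; ring.
    lra.
  - move=> j; have [n0j|jn0] := leP n0 j.
      have := U0_tail n0j; rewrite /w; have := E0 0 j; nra.
    apply: (@le_trans _ _ 0); last by have /andP[] := U_bounds 0 j; lra.
    rewrite /w.
    have : tail_wave mu 0 j <= D * E 0 j.
      apply: (@le_trans _ _ (expR ((nu - mu) * n0%:~R) *
                             expR (- nu * (j%:~R - C 0)))).
        rewrite tail_wave_mu -expRD ler_expR.
        have -> : C 0 = 0 by rewrite /C I0; ring.
        have : (nu - mu) * j%:~R <= (nu - mu) * n0%:~R.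
          by rewrite ler_wpM2l ?ler_int ?ltW// subr_gt0.
        lra.
      by apply: ler_pM => //; exact: expR_ge0.
    lra.
(* For xi >= X the correction D E is at most half of the tail wave. *)
pose X := ln (2 * (D * expR B)) / (nu - mu).
exists X => t i t0 Xi.
apply: le_trans (wU t i t0); rewrite /w.
have DE : D * E t i <= tail_wave mu t i / 2.
  have DB0 : 0 < D * expR B by rewrite mulr_gt0 ?expR_gt0.
  apply: (@le_trans _ _ (D * (expR B * expR (- nu * (i%:~R - C t))))).
    by rewrite ler_wpM2l// ltW.
  have -> : expR (- nu * (i%:~R - C t)) =
      tail_wave mu t i * expR (- (nu - mu) * (i%:~R - C t)).
    by rewrite tail_wave_mu -expRD; congr expR; ring.
  have : expR (- (nu - mu) * (i%:~R - C t)) <= (2 * (D * expR B))^-1.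
    have -> : (2 * (D * expR B))^-1 = expR (- ln (2 * (D * expR B))).
      by rewrite expRN lnK// posrE mulr_gt0.
    by rewrite ler_expR mulNr lerN2 [leRHS]mulrC -ler_pdivrMr//; exact: Xi.
  move=> /(ler_wpM2l (ltW (tail_wave_gt0 mu t i))) /(ler_wpM2l (ltW DB0)).
  have -> : D * expR B * (tail_wave mu t i * (2 * (D * expR B))^-1) =
      tail_wave mu t i / 2.
    by field; rewrite !gt_eqF ?expR_gt0.
  lra.
lra.
Qed.

(** A site at xi >= - K was at xi >= X a fixed time tau earlier, because the
    front advances at least at speed dispersion mu / mu; since the loss in the
    equation is at most 2 U, the value U can only drop by the factor
    e^(- 2 tau) meanwhile. *)
Lemma front_lower_bound (K : R) : exists tau del : R, [/\ 0 <= tau, 0 < del &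
  forall t i, tau <= t -> - K <= i%:~R - C t -> del * tail_wave mu t i <= U t i].
Proof.
have mu0 := mu_gt0; have [X HX] := front_tail.
have v0 : 0 < dispersion mu / mu by rewrite divr_gt0 ?dispersion_gt0.
(* In time tau the front advances by at least X + K, and by at most G. *)
pose tau : R := Num.max 0 ((X + K) / (dispersion mu / mu)).
have tau0 : 0 <= tau by rewrite le_max lexx.
have [B B0 HB] := primitive_increment_bounded tau.
pose G := (dispersion mu * tau + B) / mu.
exists tau, (expR (- (2 * tau)) * expR (- (mu * G)) / 4).
split => //; first by rewrite !mulr_gt0 ?expR_gt0.
move=> t i taut Ki; pose s := t - tau.
have st : s <= t by rewrite /s; lra.
have s0 : 0 <= s by rewrite /s; lra.
have ts : t - s = tau by rewrite /s; ring.
have adv : X + K <= C t - C s.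
  apply: le_trans (front_position_advance st); rewrite ts mulrC -ler_pdivrMr//.
  by rewrite le_max lexx orbT.
have CG : C t - C s <= G.
  rewrite /C /G -mulrBl ler_pM2r ?invr_gt0//.
  have := HB _ _ st; rewrite ts => /(_ (lexx _)).
  have -> : dispersion mu * tau = dispersion mu * t - dispersion mu * s.
    by rewrite -ts; ring.
  lra.
have h1 : tail_wave mu s i / 4 <= U s i by apply: HX => //; lra.
have h2 : expR (- (mu * G)) * tail_wave mu t i <= tail_wave mu s i.
  rewrite !tail_wave_mu -expRD ler_expR.
  by have := ler_wpM2l (ltW mu_gt0) CG; lra.
have h3 : expR (- (2 * tau)) * U s i <= U t i.
  pose V x := expR (2 * x) * U x i.
  pose dV x := expR (2 * x) * (2 * U x i + kpp (al x) (U x) i).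
  have Vd x : is_derive x 1 V (dV x).
    by have d1 := U_solution x i; rewrite /V /dV; compute_derivative; ring.
  have [x _ e] := mean_value st Vd.
  have Vst : V s <= V t.
    rewrite -subr_ge0 e mulr_ge0 ?subr_ge0// mulr_ge0 ?expR_ge0// /kpp.
    have /andP[a1 a2] := U_bounds x i.
    have /andP[b1 _] := U_bounds x (i + 1).
    have /andP[c1 _] := U_bounds x (i - 1).
    have : 0 <= al x * U x i * (1 - U x i).
      by apply: mulr_ge0; [apply: mulr_ge0; exact: ltW | lra].
    lra.
  have -> : - (2 * tau) = 2 * s - 2 * t by rewrite -ts; ring.
  by rewrite expRD mulrAC -/(V s) expRN ler_pdivrMr ?expR_gt0// [leRHS]mulrC.
have e0 := expR_ge0 (- (2 * tau)).
have := ler_wpM2l e0 h1; have := ler_wpM2l e0 h2.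
lra.
Qed.

(** ** Enclosing a perturbed solution *)

Variable K0 : R.
Hypothesis U_left : forall t i, i%:~R - C t < - K0 -> 1 / 2 <= U t i.

Variable v : R -> int -> R.
Hypothesis v_within_continuous :
  forall t i, {within `[0, t], continuous (v ^~ i)}.
Hypothesis v_solution : forall t i, 0 < t ->
  is_derive t 1 (v ^~ i) (kpp (al t) (v t) i).
Hypothesis v_bounded : forall t1, exists2 M : R, 0 <= M &
  forall t i, 0 <= t -> t <= t1 -> `|v t i| <= M.

Lemma sub_le_solution (w dw : R -> int -> R) t0 t1 M : 0 <= t0 ->
  (forall t i, is_derive t 1 (w ^~ i) (dw t i)) ->
  (forall t i, t0 <= t -> w t i <= M) ->
  (forall t i, t0 < t -> v t i < w t i -> dw t i <= kpp (al t) (w t) i) ->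
  (forall i, w t0 i <= v t0 i) ->
  forall i, t0 <= t1 -> w t1 i <= v t1 i.
Proof.
move=> t00 wd wM wsub w0 i t01.
have [A alA] := al_bounded t0 t1.
have [N N0 vN] := v_bounded t1.
have NM : 0 <= N + `|M| by rewrite addr_ge0.
apply: (@kpp_comparison _ al w v dw (fun s j => kpp (al s) (v s) j) t0 t1 A
  (N + `|M|)) => //.
- by move=> j; exact: (is_derive_within_continuous (fun x _ _ => wd x j)).
- move=> j; apply: continuous_subspaceW (@v_within_continuous t1 j).
  by apply: subset_itvr; rewrite bnd_simp.
- by move=> t j t0t _; have := wM t j t0t; have := ler_norm M; lra.
- move=> t j t0t tt1; have := vN t j (le_trans t00 t0t) tt1.
  by rewrite ler_norml => /andP[]; have := normr_ge0 M; lra.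
- move=> t j t0t tt1 vw; split => //; last exact: wsub.
  by apply: v_solution; lra.
Qed.

Lemma solution_le_super (w dw : R -> int -> R) t0 t1 M : 0 <= t0 ->
  (forall t i, is_derive t 1 (w ^~ i) (dw t i)) ->
  (forall t i, t0 <= t -> - M <= w t i) ->
  (forall t i, t0 < t -> w t i < v t i -> kpp (al t) (w t) i <= dw t i) ->
  (forall i, v t0 i <= w t0 i) ->
  forall i, t0 <= t1 -> v t1 i <= w t1 i.
Proof.
move=> t00 wd wM wsub w0 i t01.
have [A alA] := al_bounded t0 t1.
have [N N0 vN] := v_bounded t1.
have NM : 0 <= N + `|M| by rewrite addr_ge0.
apply: (@kpp_comparison _ al v w (fun s j => kpp (al s) (v s) j) dw t0 t1 A
  (N + `|M|)) => //.
- move=> j; apply: continuous_subspaceW (@v_within_continuous t1 j).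
  by apply: subset_itvr; rewrite bnd_simp.
- by move=> j; exact: (is_derive_within_continuous (fun x _ _ => wd x j)).
- move=> t j t0t tt1; have := vN t j (le_trans t00 t0t) tt1.
  by rewrite ler_norml => /andP[]; have := normr_ge0 M; lra.
- by move=> t j t0t _; have := wM t j t0t; have := ler_norm M; lra.
- move=> t j t0t tt1 vw; split => //; last exact: wsub.
  by apply: v_solution; lra.
Qed.

Variable sig : R.
Hypothesis sig_gt0 : 0 < sig.
Hypothesis sig_le : sig <= 1 / 2.
Hypothesis v0_ge : forall i, sig * U 0 i <= v 0 i.
Hypothesis v0_tail : forall e : R, 0 < e -> exists n : int, forall i, n <= i ->
  (1 - e) * U 0 i <= v 0 i <= (1 + e) * U 0 i.

Lemma solution_ge0 t i : 0 <= t -> 0 <= v t i.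
Proof.
move=> t0; apply: (@sub_le_solution (fun _ _ => 0) (fun _ _ => 0) 0 t 0) => //.
- by move=> s j; exact: is_derive_const.
- by move=> s j _ _; rewrite /kpp !(mulr0, mul0r, subr0, addr0).
- move=> j; apply: le_trans (v0_ge j).
  by apply: mulr_ge0; [exact: ltW | have /andP[/ltW] := U_bounds 0 j].
Qed.

(** Multiplying U by 1 + e turns it into a strict supersolution, since the
    quadratic term (1 + e) U^2 falls below ((1 + e) U)^2; adding a solution of
    the linearised equation preserves this.  The lower barrier is used only
    where it exceeds v >= 0, hence where it is positive and at most
    (1 - e) U. *)
Lemma sandwich (e : R) : 0 < e -> e < 1 -> exists2 M : R, 0 <= M &
  forall t i, 0 <= t ->
    (1 - e) * U t i - M * tail_wave nu t i <= v t i /\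
    v t i <= (1 + e) * U t i + M * tail_wave nu t i.
Proof.
move=> e0 e1.
have munu := mu_nu; have mu0 := mu_gt0.
have [n tail] := v0_tail e0.
have [N N0 vN] := v_bounded 0.
pose M := (N + 1) * expR (nu * n%:~R).
have M0 : 0 <= M by rewrite mulr_ge0 ?expR_ge0//; lra.
have MP t i : 0 <= M * tail_wave nu t i.
  by rewrite mulr_ge0// ltW// tail_wave_gt0.
have init i : i < n -> N + 1 <= M * tail_wave nu 0 i.
  move=> ltin; rewrite /M /tail_wave mulr0 addr0 I0 addr0 -mulrA -expRD.
  rewrite ler_peMr//; first lra.
  rewrite -[leLHS]expR0 ler_expR mulNr subr_ge0 ler_wpM2l ?ler_int ?ltW//.
  by lra.
have dP t i := is_derive_tail_wave nu t i.
have dU t i := U_solution t i.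
exists M => // t i t0; split.
- pose w s j := (1 - e) * U s j - M * tail_wave nu s j.
  pose dw s j := (1 - e) * kpp (al s) (U s) j -
    M * ((dispersion nu + al s) * tail_wave nu s j).
  have wd s j : is_derive s 1 (w ^~ j) (dw s j).
    by rewrite /w /dw; compute_derivative; ring.
  apply: (@sub_le_solution w dw 0 t 1) => //; rewrite /w /dw.
  + move=> s j _; have /andP[U0 U1] := U_bounds s j; have := MP s j.
    have : 0 <= e * U s j by rewrite mulr_ge0// ltW.
    lra.
  + move=> s j s0; set W := (1 - e) * U s j - M * tail_wave nu s j => vW.
    have W0 : 0 < W by have := solution_ge0 j (ltW s0); lra.
    have /andP[U0 U1] := U_bounds s j.
    have lap := tail_wave_laplacian nu s j.
    have WW : W ^+ 2 <= (1 - e) * U s j ^+ 2.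
      apply: (@le_trans _ _ (((1 - e) * U s j) ^+ 2)).
        have mp := MP s j; rewrite /W in W0 *.
        by rewrite ler_sqr ?nnegrE ?mulr_ge0//; lra.
      rewrite exprMn ler_wpM2r ?sqr_ge0//; nra.
    rewrite -subr_ge0 (_ : _ - _ = al s * ((1 - e) * U s j ^+ 2 - W ^+ 2)).
      by rewrite mulr_ge0 ?subr_ge0// ltW.
    by rewrite /kpp [(dispersion nu + al s) * _]mulrDl -lap /W; ring.
  + move=> j; have [/tail/andP[h _]|/init h] := leP n j.
      by have := MP 0 j; lra.
    have /andP[U0 U1] := U_bounds 0 j.
    have : 0 <= e * U 0 j by rewrite mulr_ge0// ltW.
    have := vN 0 j (lexx _) (lexx _); rewrite ler_norml => /andP[]; lra.
- pose w s j := (1 + e) * U s j + M * tail_wave nu s j.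
  pose dw s j := (1 + e) * kpp (al s) (U s) j +
    M * ((dispersion nu + al s) * tail_wave nu s j).
  have wd s j : is_derive s 1 (w ^~ j) (dw s j).
    by rewrite /w /dw; compute_derivative; ring.
  apply: (@solution_le_super w dw 0 t 0) => //; rewrite /w /dw.
  + move=> s j _; have /andP[U0 U1] := U_bounds s j; have := MP s j.
    have : 0 <= e * U s j by rewrite mulr_ge0// ltW.
    lra.
  + move=> s j s0 _; set W := (1 + e) * U s j + M * tail_wave nu s j.
    have /andP[U0 U1] := U_bounds s j.
    have lap := tail_wave_laplacian nu s j.
    have WW : (1 + e) * U s j ^+ 2 <= W ^+ 2.
      apply: (@le_trans _ _ (((1 + e) * U s j) ^+ 2)).
        by rewrite exprMn ler_wpM2r ?sqr_ge0//; nra.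
      rewrite ler_sqr ?nnegrE /W.
      + by have := MP s j; lra.
      + by rewrite mulr_ge0//; lra.
      + by rewrite addr_ge0// mulr_ge0//; lra.
    rewrite -subr_ge0 (_ : _ - _ = al s * (W ^+ 2 - (1 + e) * U s j ^+ 2)).
      by rewrite mulr_ge0 ?subr_ge0// ltW.
    by rewrite /kpp [(dispersion nu + al s) * _]mulrDl -lap /W; ring.
  + move=> j; have [/tail/andP[_ h]|/init h] := leP n j.
      by have := MP 0 j; lra.
    have /andP[U0 U1] := U_bounds 0 j.
    have : 0 <= e * U 0 j by rewrite mulr_ge0// ltW.
    have := vN 0 j (lexx _) (lexx _); rewrite ler_norml => /andP[]; lra.
Qed.

(** The integral of al diverges at least linearly. *)
Lemma primitive_decay (gam B e t0 : R) : 0 < gam -> 0 <= B -> 0 < e ->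
  exists2 T : R, t0 <= T &
    forall t, T <= t -> B * expR (- (gam * (I t - I t0))) <= e.
Proof.
move=> gam0 B0 e0; have lo0 := lo_gt0; have rlo0 := rlo_gt0.
have k0 : 0 < e * gam * lo by rewrite !mulr_gt0.
have b0 : 0 <= B / (e * gam * lo) by rewrite divr_ge0// ltW.
exists (t0 + rlo + B / (e * gam * lo)); first lra.
move=> t Tt.
have h1 : lo * (t - t0) <= I t - I t0 by apply: lower; lra.
have h2 : B <= e * gam * lo * (t - t0).
  by rewrite mulrC -ler_pdivrMr//; lra.
have h3 : e * gam * lo * (t - t0) <= e * expR (gam * (I t - I t0)).
  rewrite -!mulrA ler_wpM2l ?(ltW e0)//.
  apply: le_trans (_ : 1 + gam * (I t - I t0) <= _); last exact: expR_ge1Dx.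
  by have := ler_wpM2l (ltW gam0) h1; lra.
by rewrite expRN ler_pdivrMr ?expR_gt0//; lra.
Qed.

(** In [sandwich] the error M P_nu is small relative to U: it equals P_mu times
    a factor bounded on xi >= - K times e^(- (p t + q I(t))), and U controls
    P_mu there. *)
Lemma close_ahead (e K : R) : 0 < e -> e < 1 -> exists2 T : R, 0 <= T &
  forall t i, T <= t -> - K <= i%:~R - C t ->
    (1 - e) * U t i <= v t i /\ v t i <= (1 + e) * U t i.
Proof.
move=> e0 e1; have munu := mu_nu; have q0 := drift_q_gt0; have kap0 := drift.
have [|//|M M0 HM] := @sandwich (e / 2); [lra|lra|].
have [tau [del [tau0 del0 Hdel]]] := front_lower_bound K.
pose H := M * expR ((nu - mu) * K).
have H0 : 0 <= H by rewrite mulr_ge0// expR_ge0.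
have k0 : 0 < e / 2 * del * (p + q * lo) by rewrite !mulr_gt0//; lra.
have rlo0 := rlo_gt0.
have b0 : 0 <= H / (e / 2 * del * (p + q * lo)) by rewrite divr_ge0// ltW.
exists (tau + rlo + H / (e / 2 * del * (p + q * lo))); first lra.
move=> t i Tt Ki.
have t0 : 0 <= t by lra.
have Pmu0 := tail_wave_gt0 mu t i.
have small : M * tail_wave nu t i <= e / 2 * U t i.
  have hU : del * tail_wave mu t i <= U t i by apply: Hdel => //; lra.
  have It : lo * t <= I t.
    by have := @lower 0 t; rewrite I0 !subr0; apply; lra.
  have h2 : H <= e / 2 * del * expR (p * t + q * I t).
    apply: (@le_trans _ _ (e / 2 * del * (p + q * lo) * t)).
      by rewrite mulrC -ler_pdivrMr//; lra.
    rewrite -[_ * _ * t]mulrA ler_wpM2l//; first by rewrite mulr_ge0//; lra.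
    apply: le_trans (_ : 1 + (p * t + q * I t) <= _); last exact: expR_ge1Dx.
    by have := ler_wpM2l (ltW q0) It; lra.
  have h3 : expR (- (nu - mu) * (i%:~R - C t)) <= expR ((nu - mu) * K).
    rewrite ler_expR.
    have : 0 <= (nu - mu) * (K + (i%:~R - C t)) by apply: mulr_ge0; lra.
    lra.
  rewrite tail_wave_ratio expRN mulrA ler_pdivrMr ?expR_gt0//.
  apply: (@le_trans _ _ (tail_wave mu t i * H)).
    rewrite [_ * H]mulrCA ler_wpM2l// ler_wpM2l//; exact: ltW.
  have := ler_wpM2l (ltW Pmu0) h2.
  have e2 : 0 <= e / 2 * expR (p * t + q * I t) by rewrite mulr_ge0 ?expR_ge0//; lra.
  have := ler_wpM2l e2 hU; lra.
have [] := HM t i t0; lra.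
Qed.

(** With W = y U the Laplacian terms cancel and
    dW/dt - kpp W = U (y' - al y (1 - y) U). *)
Lemma modulated_front_le_solution (y dy : R -> R) t0 t1 Y : 0 <= t0 ->
  (forall t, is_derive t 1 y (dy t)) -> (forall t, t0 <= t -> 0 <= y t <= Y) ->
  (forall t i, t0 < t -> v t i < y t * U t i ->
     dy t <= al t * (y t * (1 - y t) * U t i)) ->
  (forall i, y t0 * U t0 i <= v t0 i) ->
  forall i, t0 <= t1 -> y t1 * U t1 i <= v t1 i.
Proof.
move=> t00 yd yY ysub y0 i t01.
have dU t j := U_solution t j.
pose w s j := y s * U s j.
pose dw s j := dy s * U s j + y s * kpp (al s) (U s) j.
have wd s j : is_derive s 1 (w ^~ j) (dw s j).
  by rewrite /w /dw; compute_derivative; ring.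
apply: (@sub_le_solution w dw t0 t1 Y) => //; rewrite /w /dw.
- move=> s j t0s; have /andP[y1 yY'] := yY s t0s.
  have /andP[U0 U1] := U_bounds s j.
  by apply: le_trans yY'; rewrite ler_piMr// ltW.
- move=> s j t0s vw; have /andP[U0 _] := U_bounds s j.
  have := ler_wpM2r (ltW U0) (ysub s j t0s vw); rewrite /kpp; lra.
Qed.

Lemma solution_le_modulated_front (y dy : R -> R) t0 t1 : 0 <= t0 ->
  (forall t, is_derive t 1 y (dy t)) -> (forall t, t0 <= t -> 0 <= y t) ->
  (forall t i, t0 < t -> y t * U t i < v t i ->
     al t * (y t * (1 - y t) * U t i) <= dy t) ->
  (forall i, v t0 i <= y t0 * U t0 i) ->
  forall i, t0 <= t1 -> v t1 i <= y t1 * U t1 i.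
Proof.
move=> t00 yd y_ge0 ysup y0 i t01.
have dU t j := U_solution t j.
pose w s j := y s * U s j.
pose dw s j := dy s * U s j + y s * kpp (al s) (U s) j.
have wd s j : is_derive s 1 (w ^~ j) (dw s j).
  by rewrite /w /dw; compute_derivative; ring.
apply: (@solution_le_super w dw t0 t1 0) => //; rewrite /w /dw.
- move=> s j t0s; have /andP[U0 U1] := U_bounds s j.
  by rewrite oppr0 mulr_ge0 ?y_ge0// ltW.
- move=> s j t0s vw; have /andP[U0 _] := U_bounds s j.
  have := ler_wpM2r (ltW U0) (ysup s j t0s vw); rewrite /kpp; lra.
Qed.

(** The factor y solves y' = gam al (Y - y), so it relaxes from sig to
    Y = 1 - e / 2.  A contact y U > v forces v < Y U, which by [close_ahead]
    happens only behind the front, where U >= 1/2 and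
    gam (Y - y) <= y (1 - y) U thanks to gam = sig / 2 <= y / 2. *)
Lemma solution_eventually_ge (e : R) : 0 < e -> e < 1 -> exists T : R,
  forall t i, T <= t -> (1 - e) * U t i <= v t i.
Proof.
move=> e0 e1; have sig0 := sig_gt0; have sigle := sig_le.
have [||t0 t00 ahead] := @close_ahead (e / 2) K0; [lra|lra|].
pose Y := 1 - e / 2.
have sigv i : sig * U t0 i <= v t0 i.
  have dsig t : is_derive t 1 (fun=> sig) 0 by exact: is_derive_const.
  apply: (@modulated_front_le_solution (fun=> sig) (fun=> 0) 0 t0 1) => //.
  - by move=> t _; lra.
  - move=> t j _ _; have /andP[U0 _] := U_bounds t j.
    by rewrite !mulr_ge0//; first exact: ltW; lra.
pose gam := sig / 2.
pose y t := Y - (Y - sig) * expR (- (gam * (I t - I t0))).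
pose dy t := gam * al t * (Y - y t).
have dIt t := dI t.
have dyE t : is_derive t 1 y (dy t).
  by rewrite /y /dy /y; compute_derivative; ring.
have yb t : t0 <= t -> sig <= y t <= Y.
  move=> t0t.
  have E0 := expR_ge0 (- (gam * (I t - I t0))).
  have E1 : expR (- (gam * (I t - I t0))) <= 1.
    rewrite -[leRHS]expR0 ler_expR oppr_le0 mulr_ge0 ?subr_ge0 ?primitive_mono//.
    by rewrite /gam; lra.
  have sY : 0 <= Y - sig by rewrite /Y; lra.
  have := ler_wpM2l sY E1; have := mulr_ge0 sY E0; rewrite /y; lra.
have gam0 : 0 < gam by rewrite /gam; lra.
have e20 : 0 < e / 2 by lra.
have [T t0T HT] := primitive_decay t0 gam0 ler01 e20.
exists T => t i Tt.
have t0t : t0 <= t by lra.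
apply: (@le_trans _ _ (y t * U t i)).
  have /andP[U0 _] := U_bounds t i; rewrite ler_wpM2r ?(ltW U0)//.
  have := HT t Tt; have : Y - sig <= 1 by rewrite /Y; lra.
  rewrite /y => h1; have := ler_wpM2r (expR_ge0 (- (gam * (I t - I t0)))) h1.
  rewrite /Y; lra.
apply: (@modulated_front_le_solution y dy t0 t Y) => //.
- by move=> s /yb /andP[h1 h2]; rewrite h2 andbT; lra.
- move=> s j t0s vy; have /andP[y1 y2] := yb s (ltW t0s).
  have /andP[U0 _] := U_bounds s j.
  have half : 1 / 2 <= U s j.
    apply: U_left; rewrite ltNge; apply/negP => /ahead - /(_ (ltW t0s))[h _].
    have := ler_wpM2r (ltW U0) y2; rewrite /Y; lra.
  have -> : dy s = al s * (gam * (Y - y s)) by rewrite /dy; ring.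
  rewrite ler_wpM2l ?(ltW (al_gt0 s))//.
  have Y1 : Y - y s <= 1 - y s by rewrite /Y; lra.
  have y1' : 0 <= 1 - y s by rewrite /Y in y2; lra.
  apply: (@le_trans _ _ (gam * (1 - y s))).
    by rewrite ler_wpM2l// ltW.
  have -> : y s * (1 - y s) * U s j = (y s * U s j) * (1 - y s) by ring.
  rewrite ler_wpM2r// /gam.
  have : sig * U s j <= y s * U s j by rewrite ler_wpM2r// ltW.
  have := ler_wpM2l (ltW sig0) half; lra.
- move=> j; rewrite /y subrr mulr0 oppr0 expR0 mulr1.
  by have -> : Y - (Y - sig) = sig by ring.
Qed.

(** The mirror image of [solution_eventually_ge]: y decreases to 1 + e / 2 from
    a value N so large that v <= N U at the starting time, which behind the
    front uses U >= 1/2. *)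
Lemma solution_eventually_le (e : R) : 0 < e -> e < 1 -> exists T : R,
  forall t i, T <= t -> v t i <= (1 + e) * U t i.
Proof.
move=> e0 e1.
have [||t0 t00 ahead] := @close_ahead (e / 2) K0; [lra|lra|].
pose Y := 1 + e / 2.
have [M M0 vM] := v_bounded t0.
pose N := 2 * M + 2.
have YN : Y <= N by rewrite /Y /N; lra.
have Nv i : v t0 i <= N * U t0 i.
  have /andP[U0 _] := U_bounds t0 i.
  have [h|h] := ltP (i%:~R - C t0) (- K0); last first.
    have [_ h1] := ahead t0 i (lexx _) h.
    by apply: le_trans h1 _; rewrite ler_wpM2r// ltW.
  have := vM t0 i t00 (lexx _); have := ler_norm (v t0 i).
  have N0 : 0 <= N by rewrite /N; lra.
  have := ler_wpM2l N0 (U_left h); rewrite /N; lra.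
pose gam : R := 1 / 2.
pose y t := Y + (N - Y) * expR (- (gam * (I t - I t0))).
pose dy t := - (gam * al t * (y t - Y)).
have dIt t := dI t.
have dyE t : is_derive t 1 y (dy t).
  by rewrite /y /dy /y; compute_derivative; ring.
have yb t : Y <= y t.
  by rewrite lerDl mulr_ge0 ?expR_ge0// subr_ge0.
have gam0 : 0 < gam by rewrite /gam; lra.
have e20 : 0 < e / 2 by lra.
have NY : 0 <= N - Y by lra.
have [T t0T HT] := primitive_decay t0 gam0 NY e20.
exists T => t i Tt.
have t0t : t0 <= t by lra.
apply: (@le_trans _ _ (y t * U t i)); last first.
  have /andP[U0 _] := U_bounds t i; rewrite ler_wpM2r ?(ltW U0)//.
  by have := HT t Tt; rewrite /y /Y; lra.
apply: (@solution_le_modulated_front y dy t0 t) => //.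
- by move=> s _; have := yb s; rewrite /Y; lra.
- move=> s j t0s vy; have y2 := yb s.
  have /andP[U0 _] := U_bounds s j.
  have half : 1 / 2 <= U s j.
    apply: U_left; rewrite ltNge; apply/negP => /ahead - /(_ (ltW t0s))[_ h].
    have := ler_wpM2r (ltW U0) y2; rewrite /Y; lra.
  have -> : dy s = al s * - (gam * (y s - Y)) by rewrite /dy; ring.
  rewrite ler_wpM2l ?(ltW (al_gt0 s))//.
  have y1 : 0 <= y s - 1 by rewrite /Y in y2; lra.
  have yU : gam <= y s * U s j.
    have : 1 * U s j <= y s * U s j by rewrite ler_wpM2r ?(ltW U0)//; lra.
    by rewrite /gam; lra.
  have := ler_wpM2r y1 yU.
  have : gam * (y s - Y) <= gam * (y s - 1).
    by rewrite ler_wpM2l ?(ltW gam0)// /Y; lra.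
  lra.
- by move=> j; rewrite /y subrr mulr0 oppr0 expR0 mulr1 addrC subrK.
Qed.

End Medium.

(** * Regularity of forward solutions *)

Section ForwardSolution.
Context {R : realType}.
Implicit Types (s t h e M : R) (i : int) (x : int -> R).

Lemma linf_norm_ub x i : (`|x i|%:E <= linf_norm x)%E.
Proof. by apply: ereal_sup_ubound; exists i. Qed.

Lemma linf_norm_ge0 x : (0 <= linf_norm x)%E.
Proof. by apply: le_trans (linf_norm_ub x 0); rewrite lee_fin. Qed.

Lemma linf_norm_le x M : (forall i, `|x i| <= M) -> (linf_norm x <= M%:E)%E.
Proof. by move=> xM; apply: ge_ereal_sup => _ [i _ <-]; rewrite lee_fin. Qed.

Lemma linf_fineK x : linf x -> (fine (linf_norm x))%:E = linf_norm x.
Proof. by move=> lx; rewrite fineK// ge0_fin_numE ?linf_norm_ge0. Qed.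

Lemma linf_le_fine x i : linf x -> `|x i| <= fine (linf_norm x).
Proof. by move=> lx; rewrite -lee_fin linf_fineK// linf_norm_ub. Qed.

Lemma fine_linf_norm_le x M : linf x -> (forall i, `|x i| <= M) ->
  fine (linf_norm x) <= M.
Proof. by move=> lx xM; rewrite -lee_fin linf_fineK// linf_norm_le. Qed.

Lemma locally_lipschitz_within_continuous (f : R -> R) t1 :
  (forall t, 0 <= t -> exists K d, 0 < d /\ forall s, 0 <= s ->
     `|s - t| < d -> `|f s - f t| <= K * `|s - t|) ->
  {within `[0, t1], continuous f}.
Proof.
move=> flip; apply/subspace_continuousP => t /=.
rewrite in_itv/= => /andP[t0 tt1]; have [K [d [d0 fK]]] := flip t t0.
apply/cvgrPdist_le => /= e e0.
have K0 : 0 < `|K| + 1 by rewrite ltr_wpDl.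
rewrite near_withinE; near=> s => /andP[s0 _].
have sd : `|s - t| < d.
  by rewrite distrC; near: s; apply/nbhs_ballP; exists d.
rewrite distrC; apply: le_trans (fK s s0 sd) _.
apply: (@le_trans _ _ ((`|K| + 1) * `|s - t|)).
  by rewrite ler_wpM2r//; have := ler_norm K; lra.
rewrite mulrC -ler_pdivlMr// distrC ltW//; near: s.
by apply/nbhs_ballP; exists (e / (`|K| + 1)) => //; exact: divr_gt0.
Unshelve. all: by end_near. Qed.

Variables (al : R -> R) (u0 : int -> R) (v : R -> int -> R).
Hypothesis v_forward : linf_forward_solution al u0 v.

(** Norm differentiability makes the difference quotients converge uniformly
    over the lattice. *)
Lemma forward_quotient t e : 0 <= t -> 0 < e -> exists2 d, 0 < d &
  forall h i, h != 0 -> `|h| < d -> 0 <= t + h ->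
    `|h^-1 * (v (t + h) i - v t i) - kpp (al t) (v t) i| < e.
Proof.
move=> t0 e0; have [_ /(_ t t0)[_ vq]] := v_forward.
have : nbhs (0%E : \bar R) [set y : \bar R | (y < e%:E)%E].
  apply: open_nbhs_nbhs; split; first exact: open_ereal_lt_ereal.
  by rewrite /= lte_fin.
move=> /vq /nbhs_ballP[d /= d0 dq]; exists d => // h i h0 hd th.
have := dq h; rewrite /ball/= sub0r normrN => /(_ hd h0 th) /=.
by rewrite -lte_fin; apply: le_lt_trans; exact: linf_norm_ub.
Qed.

Lemma forward_solution_is_derive t i : 0 < t ->
  is_derive t 1 (v ^~ i) (kpp (al t) (v t) i).
Proof.
move=> t0.
have cv : h^-1 *: (((v ^~ i) \o shift t) (h *: (1 : R)) - v t i)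
    @[h --> (0 : R)^'] --> kpp (al t) (v t) i.
  apply/cvgrPdist_lt => /= e e0.
  have [d d0 dq] := forward_quotient (ltW t0) e0.
  apply/nbhs_ballP; exists (Num.min d t); first by rewrite /= lt_min d0.
  move=> h; rewrite /ball/= sub0r normrN lt_min => /andP[hd ht] h0.
  have th : 0 <= t + h by move: ht; rewrite ltr_norml => /andP[]; lra.
  rewrite distrC; have := dq h i h0 hd th.
  by rewrite /shift/= [h *: 1]mulr1 [h + t]addrC.
apply: DeriveDef; first by apply/cvg_ex; exists (kpp (al t) (v t) i).
exact: cvg_lim cv.
Qed.

Lemma forward_solution_locally_lipschitz t : 0 <= t ->
  exists K d, 0 < d /\ forall s i, 0 <= s -> `|s - t| < d ->
    `|v s i - v t i| <= K * `|s - t|.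
Proof.
move=> t0; have [d d0 dq] := forward_quotient t0 ltr01.
have [_ /(_ t t0)[lv _]] := v_forward.
pose M := fine (linf_norm (v t)).
have vM i : `|v t i| <= M by exact: linf_le_fine.
have M0 : 0 <= M by apply: le_trans (vM 0).
exists (1 + (4 * M + `|al t| * M * (1 + M))), d; split => // s i s0 sd.
have [->|st] := eqVneq s t; first by rewrite !subrr normr0 mulr0.
have h0 : s - t != 0 by rewrite subr_eq0.
have := dq (s - t) i h0 sd; rewrite addrC subrK => /(_ s0) q1.
have kM : `|kpp (al t) (v t) i| <= 4 * M + `|al t| * M * (1 + M).
  rewrite /kpp.
  have h1 := vM (i + 1); have h2 := vM (i - 1); have h3 := vM i.
  have h4 : `|1 - v t i| <= 1 + M.
    by apply: le_trans (ler_normB _ _) _; rewrite normr1; lra.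
  have h5 : `|al t * v t i * (1 - v t i)| <= `|al t| * M * (1 + M).
    by rewrite !normrM; apply: ler_pM => //; rewrite ler_wpM2l.
  move: h1 h2 h3 h5; rewrite !ler_norml; lra.
have -> : v s i - v t i = (s - t) * ((s - t)^-1 * (v s i - v t i)).
  by rewrite mulVKf.
rewrite normrM mulrC ler_wpM2r//.
set Q := _^-1 * _ in q1 *; set k := kpp _ _ _ in q1 kM.
have -> : Q = (Q - k) + k by ring.
by apply: le_trans (ler_normD _ _) _; lra.
Qed.

Lemma forward_solution_within_continuous t1 i :
  {within `[0, t1], continuous (v ^~ i)}.
Proof.
apply: locally_lipschitz_within_continuous => t t0.
have [K [d [d0 H]]] := forward_solution_locally_lipschitz t0.
by exists K, d; split => // s; exact: H.
Qed.

(** The norm of v(t) is locally Lipschitz in t, hence attains its maximum on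
    a compact interval of times. *)
Lemma forward_solution_bounded t1 : exists2 M : R, 0 <= M &
  forall t i, 0 <= t -> t <= t1 -> `|v t i| <= M.
Proof.
have lv t : 0 <= t -> linf (v t) by have [_ H] := v_forward; move=> /H[].
pose N t := fine (linf_norm (v t)).
have [t10|t10] := ltP t1 0.
  by exists 0 => // t i t0 tt1; exfalso; lra.
have [c _ Nc] : exists2 c, c \in `[0, t1] & forall t, t \in `[0, t1] -> N t <= N c.
  apply: EVT_max => //; apply: locally_lipschitz_within_continuous => t t0.
  have [K [d [d0 H]]] := forward_solution_locally_lipschitz t0.
  exists K, d; split => // s s0 sd.
  have h1 : N s <= N t + K * `|s - t|.
    apply: fine_linf_norm_le => [|i]; first exact: lv.
    have := H s i s0 sd; have := linf_le_fine i (lv t t0).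
    have := ler_normD (v s i - v t i) (v t i); rewrite subrK -/(N t); lra.
  have h2 : N t <= N s + K * `|s - t|.
    apply: fine_linf_norm_le => [|i]; first exact: lv.
    have := H s i s0 sd; have := linf_le_fine i (lv s s0).
    have := ler_normB (v s i) (v s i - v t i).
    have -> : v s i - (v s i - v t i) = v t i by ring.
    rewrite -/(N s); lra.
  by rewrite ler_norml; apply/andP; split; lra.
exists (N c) => [|t i t0 tt1].
  have := Nc 0; rewrite in_itv/= lexx t10 => /(_ isT); apply: le_trans.
  by apply: le_trans (linf_le_fine 0 (lv 0 (lexx _))).
by apply: le_trans (linf_le_fine i (lv t t0)) _; apply: Nc; rewrite in_itv/= t0.
Qed.

End ForwardSolution.

(** * Asymptotic stability *)

Section Assembly.
Context {R : realType}.

Lemma cvg_int_tail (f : int -> R) l e : f n%:Z @[n --> \oo] --> l -> 0 < e ->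
  exists N : int, forall i, N <= i -> `|f i - l| <= e.
Proof.
move=> /cvgrPdist_le fl e0; have [N _ HN] := fl e e0.
exists N%:Z => -[n|n] //; rewrite lez_nat => Nn.
by rewrite distrC; exact: HN.
Qed.

Lemma cvg_int_ratio (f g : int -> R) e : (forall i, 0 < g i) ->
  f n%:Z / g n%:Z @[n --> \oo] --> (1 : R) -> 0 < e ->
  exists N : int, forall i, N <= i -> (1 - e) * g i <= f i <= (1 + e) * g i.
Proof.
move=> g0 fg e0.
have [N HN] := @cvg_int_tail (fun i => f i / g i) _ _ fg e0.
exists N => i /HN; rewrite ler_norml lerBrDr lerBlDr ![_ + 1]addrC.
by rewrite ler_pdivlMr// ler_pdivrMr.
Qed.

Lemma positive_drift_below (p q b : R) : 0 < b -> 0 < q -> 0 < p + q * b ->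
  exists2 b', 0 < b' < b & 0 < p + q * b'.
Proof.
move=> b0 q0 pq0; pose gap : R := Num.min b ((p + q * b) / q) / 2.
have gapb : gap <= b / 2 by rewrite ler_pM2r// ge_min lexx.
have gapq : q * gap <= (p + q * b) / 2.
  rewrite /gap mulrA ler_pM2r// mulrC -ler_pdivlMr//.
  by rewrite ge_min lexx orbT.
have gap0 : 0 < gap by rewrite divr_gt0// lt_min b0 divr_gt0.
by exists (b - gap); [apply/andP; split; lra | rewrite mulrBr; lra].
Qed.

Lemma oint_speed (al : R -> R) mu t : continuous al ->
  oint (fun s => speed mu (al s)) 0 t = front_position (oint al 0) mu t.
Proof.
move=> alc.
have cc : continuous (fun s => speed mu (al s)).
  move=> s; apply: cvgM; last exact: cvg_cst.
  by apply: cvgD; [exact: cvg_cst | exact: alc].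
pose g s :=
  oint (fun s => speed mu (al s)) 0 s - front_position (oint al 0) mu s.
suff : g t = g 0.
  rewrite /g /front_position !oint_refl// mulr0 addr0 mul0r subrr => /eqP.
  by rewrite subr_eq0 => /eqP.
apply: is_derive_0_is_cst => s.
have d1 := is_derive_oint s cc; have d2 := is_derive_oint s alc.
rewrite /g /front_position; compute_derivative.
by rewrite speedE; ring.
Qed.

Lemma linf_norm_cvg0 (x : R -> int -> R) :
  (forall e, 0 < e -> e < 1 -> exists T : R,
     forall t i, T <= t -> `|x t i| <= e) ->
  linf_norm (x t) @[t --> +oo] --> 0%E.
Proof.
move=> xe A A0; have : nbhs (0 : R) (fun r => A r%:E) by exact: A0.
move=> /nbhs_ballP[e /= e0 eA].
pose e' : R := Num.min (e / 2) (1 / 2).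
have e'0 : 0 < e' by rewrite lt_min; apply/andP; split; lra.
have e'1 : e' < 1 by rewrite gt_min; apply/orP; right; lra.
have e'e : e' < e by rewrite gt_min; apply/orP; left; lra.
have [T HT] := xe e' e'0 e'1.
exists T; split; first exact: num_real.
move=> t Tt /=.
have le1 : (linf_norm (x t) <= e'%:E)%E.
  by apply: linf_norm_le => i; apply: HT; exact: ltW.
have lx : linf (x t) by rewrite /linf (le_lt_trans le1)// ltry.
rewrite -linf_fineK//; apply: eA; rewrite /ball/= sub0r normrN.
rewrite ger0_norm ?fine_ge0 ?linf_norm_ge0//.
by apply: le_lt_trans e'e; rewrite -lee_fin linf_fineK.
Qed.

End Assembly.

Theorem theorem1p2 (R : realType) (d : measure_display)
  (Omega : measurableType d) (P : probability Omega R)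
  (theta : R -> Omega -> Omega)
  (theta_mds : metric_dynamical_system P theta)
  (theta_ergodic : ergodic P theta)
  (a : Omega -> R)
  (a_measurable : measurable_fun [set: Omega] a)
  (a_gt0 : forall w, 0 < a w)
  (a_hoelder : forall w, locally_hoelder (fun t => a (theta t w)))
  (a_means : {ae P, forall w,
     [/\ (0 < lower_mean (fun t => a (theta t w)))%E,
         (lower_mean (fun t => a (theta t w))
            <= upper_mean (fun t => a (theta t w)))%E &
         (upper_mean (fun t => a (theta t w)) < +oo)%E]})
  (a_low a_up : R) (a_low_gt0 : 0 < a_low) (a_up_gt0 : 0 < a_up)
  (Omega0 : set Omega)
  (Omega0_measurable : measurable Omega0)
  (Omega0_full : P Omega0 = 1%E)
  (Omega0_invariant : forall t, theta t @` Omega0 = Omega0)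
  (Omega0_low : forall w, Omega0 w ->
     lower_mean (fun t => a (theta t w)) = a_low%:E)
  (Omega0_up : forall w, Omega0 w ->
     upper_mean (fun t => a (theta t w)) = a_up%:E)
  (mustar : R) (mustar_gt0 : 0 < mustar)
  (mustar_min : minimal_speed a_low = speed mustar a_low)
  (mu : R) (mu_gt0 : 0 < mu) (mu_lt : mu < mustar)
  (c : R -> Omega -> R)
  (c_def : forall t w, c t w = speed mu (a (theta t w)))
  (u : R -> Omega -> int -> R) (Phi : R -> Omega -> R)
  (u_front : random_transition_front P theta a u Phi c)
  (u_front0 : forall w, Omega0 w -> front_at theta a u Phi c w)
  (u_asymptotics : forall w, Omega0 w -> forall t : R,
     u t w n%:Z / expR (- mu * (n%:R - oint (c ^~ w) 0 t))
       @[n --> \oo] --> (1 : R)) :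
  forall w, Omega0 w -> forall u0 : int -> R, linf u0 ->
    (forall i0 : int, 0 < inf [set u0 i | i in [set i : int | i <= i0]]) ->
    u0 n%:Z / u 0 w n%:Z @[n --> \oo] --> (1 : R) ->
    forall v : R -> int -> R,
      linf_forward_solution (fun t => a (theta t w)) u0 v ->
      linf_norm (fun i => v t i / u t w i - 1) @[t --> +oo] --> 0%E.
Proof.
move=> w w0 u0 u0_linf u0_inf u0_tail v v_forward.
pose al t := a (theta t w).
pose I t := oint al 0 t.
pose U t i := u t w i.
have al_gt0 t : 0 < al t by exact: a_gt0.
have al_cont : continuous al := locally_hoelder_continuous (a_hoelder w).
have dI (t : R) : is_derive t 1 I (al t) by exact: is_derive_oint.
have I0 : I 0 = 0 by exact: oint_refl.
have [rup rup0 upper] : exists2 r, 0 < r &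
    forall s t, r <= t - s -> I t - I s <= (a_up + 1) * (t - s).
  by apply: (upper_mean_le al_cont (Omega0_up w w0)); rewrite ltrDl.
have [nu /andP[mu_nu nu_le] drift_low] :=
  slower_exponent a_low_gt0 mustar_min mu_gt0 mu_lt.
pose p := nu / mu * dispersion mu - dispersion nu.
pose q := nu / mu - 1.
have q0 : 0 < q by rewrite /q subr_gt0 ltr_pdivlMr// mul1r.
have pq0 : 0 < p + q * a_low by move: drift_low; rewrite /p /q; lra.
have [lo /andP[lo0 lo_low] drift] := positive_drift_below a_low_gt0 q0 pq0.
have [rlo rlo0 lower] : exists2 r, 0 < r &
    forall s t, r <= t - s -> lo * (t - s) <= I t - I s.
  exact: (lower_mean_ge al_cont (Omega0_low w w0)).
have [U_solution U_profile _ U_left _] := u_front0 w w0.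
have w0t t : Omega0 (theta t w).
  by rewrite -(Omega0_invariant t); exists w.
(* The profile at time t is evaluated at theta t w, so the bounds come from the
   front at that sample. *)
have U_bounds t i : 0 < U t i < 1.
  by rewrite /U U_profile; have [_ _ + _ _] := u_front0 _ (w0t t); exact.
have cE t : oint (c ^~ w) 0 t = front_position I mu t.
  rewrite -oint_speed//; congr (oint _ 0 t).
  by apply/funext => s; exact: c_def.
have half0 : 0 < 1 / 2 :> R by rewrite divr_gt0.
have half : 1 - 1 / 2 = 1 / 2 :> R by field.
have [K0 U_left0] : exists K0, forall t i,
    i%:~R - front_position I mu t < - K0 -> 1 / 2 <= U t i.
  have [K [_ HK]] := U_left _ half0; exists (- K) => t i.
  rewrite opprK -cE => /HK /(_ t); rewrite -U_profile.
  rewrite ltr_norml -/(U t i) => /andP[+ _].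
  by rewrite ltrBrDr addrC half => /ltW.
have [n0 U0_tail] : exists n0 : int, forall i, n0 <= i ->
    tail_wave I mu 0 i / 2 <= U 0 i.
  have e0 : front_position I mu 0 = 0.
    by rewrite /front_position I0 mulr0 addr0 mul0r.
  have [n0 hn0] := cvg_int_ratio (fun i : int =>
    expR_gt0 (- mu * (i%:~R - oint (c ^~ w) 0 0))) (u_asymptotics w w0 0) half0.
  exists n0 => i /hn0 /andP[+ _].
  by rewrite half mul1r mulrC cE e0 subr0 /tail_wave mulr0 addr0 I0 addr0.
have v0 : v 0 = u0 by case: v_forward.
have v0_tail e : 0 < e -> exists n : int, forall i, n <= i ->
    (1 - e) * U 0 i <= v 0 i <= (1 + e) * U 0 i.
  move=> e0; rewrite v0; apply: cvg_int_ratio => // i.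
  by have /andP[] := U_bounds 0 i.
have [n hn] := v0_tail _ half0.
have lb i : i <= n -> inf [set u0 i | i in [set i : int | i <= n]] <= u0 i.
  move=> lein; apply: ge_inf; last by exists i.
  exists (- fine (linf_norm u0)) => _ [j _ <-].
  by have := linf_le_fine j u0_linf; rewrite ler_norml => /andP[].
have m0 := u0_inf n; set m := inf _ in lb m0.
(* Right of n the data is at least U / 2; left of n it is at least m, and
   U < 1. *)
pose sig : R := Num.min m (1 / 2).
have sig0 : 0 < sig by rewrite lt_min m0.
have sigm : sig <= m by rewrite ge_min lexx.
have sig2 : sig <= 1 / 2 by rewrite ge_min lexx orbT.
have v0_ge i : sig * U 0 i <= v 0 i.
  have /andP[U0 U1] := U_bounds 0 i.
  have [lein|/ltW/hn/andP[h _]] := leP i n.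
    rewrite v0; apply: (le_trans _ (lb i lein)); apply: (le_trans _ sigm).
    by rewrite ler_piMr// ltW.
  by apply: le_trans h; rewrite half ler_wpM2r ?(ltW U0).
have v_cont := forward_solution_within_continuous v_forward.
have v_der := fun t i => @forward_solution_is_derive _ _ _ _ v_forward t i.
have v_bnd := forward_solution_bounded v_forward.
apply: linf_norm_cvg0 => e e0 e1.
have [T1 H1] := solution_eventually_ge al_gt0 al_cont dI I0 rup0 upper lo0 rlo0
  lower mu_gt0 mu_nu nu_le drift U_solution U_bounds U0_tail U_left0
  v_cont v_der v_bnd sig0 sig2 v0_ge v0_tail e0 e1.
have [T2 H2] := solution_eventually_le al_gt0 al_cont dI I0 rup0 upper lo0 rlo0
  lower mu_gt0 mu_nu nu_le drift U_solution U_bounds U0_tail U_left0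
  v_cont v_der v_bnd sig0 v0_ge v0_tail e0 e1.
exists (Num.max T1 T2) => t i; rewrite ge_max => /andP[T1t T2t].
have /andP[U0 _] := U_bounds t i.
have h1 : 1 - e <= v t i / U t i by rewrite ler_pdivlMr// H1.
have h2 : v t i / U t i <= 1 + e by rewrite ler_pdivrMr// H2.
by rewrite ler_norml lerBrDr lerBlDr ![_ + 1]addrC h1 h2.
Qed.
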